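(* Let $H$ be a separable complex Hilbert space and let $\mathbf A=(T_{kj})_{k,j\in\mathbb N}$ be a Toeplitz matrix with entries in $\mathcal B(H)$. Then $\mathbf A\in\mathcal B(\ell^2(H))$ if and only if there exists $\mu\in V^\infty(\mathbb T,\mathcal B(H))$ such that $T_{kj}=\hat\mu(j-k)$ for all $k,j\in\mathbb N$. Moreover $\|\mathbf A\|_{\mathcal B(\ell^2(H))}=\|\mu\|_\infty$.
   Context: $\mathbb N=\{1,2,\dots\}$, $\mathbb T=\{z\in\mathbb C:|z|=1\}$ is identified with $[0,2\pi)$ via $t\mapsto e^{it}$, $\varphi_k(t)=e^{ikt}$, $\mathfrak B(\mathbb T)$ is the Borel $\sigma$-algebra and $m$ is normalized Lebesgue measure $\frac{dt}{2\pi}$ on $\mathbb T$. Matrices: $\mathcal B(H)$ is the space of bounded operators on $H$. $\ell^2(H)$ is the Hilbert space of square-summable sequences $\mathbf x=(x_j)_{j\in\mathbb N}$ in $H$, $c_{00}(H)$ its subspace of finitely supported sequences. For $\mathbf x\in c_{00}(H)$, $\mathbf A(\mathbf x)=\big(\sum_jT_{kj}(x_j)\big)_k$; $\mathbf A\in\mathcal B(\ell^2(H))$ means that there is $C\ge0$ with $\|\mathbf A(\mathbf x)\|_{\ell^2(H)}\le C\|\mathbf x\|_{\ell^2(H)}$ for all $\mathbf x\in c_{00}(H)$, and $\|\mathbf A\|_{\mathcal B(\ell^2(H))}$ is the least such $C$. $\mathbf A=(T_{kj})$ is a Toeplitz matrix if $T_{kj}$ depends only on $k-j$. Measures: for a Banach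 space $E$, $\mathfrak M(\mathbb T,E)$ is the space of regular ($E$-valued, countably additive) Borel vector measures $\mu:\mathfrak B(\mathbb T)\to E$, where regular means: for every $\varepsilon>0$ and $B\in\mathfrak B(\mathbb T)$ there are a compact $K$ and an open $O$ with $K\subset B\subset O$ and $\|\mu\|(O\setminus K)<\varepsilon$; here $\|\mu\|(B)=\sup_{\|e^*\|=1}|e^*\circ\mu|(B)$ is the semivariation. Each $\mu\in\mathfrak M(\mathbb T,E)$ defines a (weakly compact) operator $T_\mu:C(\mathbb T)\to E$, $T_\mu(\phi)=\int\phi\,d\mu$, and $\hat\mu(k)=T_\mu(\varphi_k)$ for $k\in\mathbb Z$. $V^\infty(\mathbb T,E)$ is the space of $\mu\in\mathfrak M(\mathbb T,E)$ for which there is $C>0$ with $\|\mu(A)\|\le C\,m(A)$ for all $A\in\mathfrak B(\mathbb T)$, with $\|\mu\|_\infty=\sup\{\|\mu(A)\|/m(A):m(A)>0\}$. *)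

(* Defs.v *)
From HB Require Import structures.
From mathcomp Require Import all_boot all_order all_algebra.
From mathcomp Require Import complex.
From mathcomp Require Import all_classical all_reals all_analysis.

Set Implicit Arguments.
Unset Strict Implicit.
Unset Printing Implicit Defensive.

Import Order.TTheory GRing.Theory Num.Theory.
Import numFieldNormedType.Exports.

Local Open Scope classical_set_scope.
Local Open Scope ring_scope.
Local Open Scope complex_scope.

(* Norms of normed modules over R[i] take values in R[i]; [rnorm] is the same
   norm as an element of R. *)
Definition rnorm (R : realType) (E : normedZmodType R[i]) (x : E) : R :=
  complex.Re `|x|.

Lemma rnormE (R : realType) (E : normedZmodType R[i]) (x : E) :
  `|x| = (rnorm x)%:C.
Proof. by rewrite /rnorm RRe_real // normr_real. Qed.

Lemma rnorm_ge0 (R : realType) (E : normedZmodType R[i]) (x : E) :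
  0 <= rnorm x.
Proof. by have := normr_ge0 x; rewrite rnormE lecR. Qed.

Lemma ler_rnormD (R : realType) (E : normedZmodType R[i]) (x y : E) :
  rnorm (x + y) <= rnorm x + rnorm y.
Proof. by have := ler_normD x y; rewrite !rnormE -rmorphD lecR. Qed.

Lemma rnormZ (R : realType) (E : normedModType R[i]) (a : R[i]) (x : E) :
  rnorm (a *: x) = rnorm (a : R[i]^o) * rnorm x.
Proof.
apply: (can_inj (f := real_complex R) (g := @complex.Re R)) => //.
by rewrite [RHS]rmorphM /= -!rnormE normrZ.
Qed.

Section BoundedOperators.
Context (R : realType) (E F : normedModType R[i]).

Definition bounded_operator (f : E -> F) : Prop :=
  linear f /\ exists M : R, forall x, rnorm (f x) <= M * rnorm x.

Definition bounded_pred : {pred E -> F} := mem [set f | bounded_operator f].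

Record blop := Blop {
  blop_fun :> E -> F;
  _ : blop_fun \in bounded_pred }.

HB.instance Definition _ := [isSub for blop_fun].
HB.instance Definition _ := [Choice of blop by <:].

Lemma boundedP (f : blop) : bounded_operator f.
Proof. by case: f => f /= /set_mem. Qed.

Lemma bounded_submod_closed : submod_closed bounded_pred.
Proof.
split=> [|a f g].
  rewrite inE; split=> [b x y|]; first by rewrite /= scaler0 addr0.
  by exists 0 => x; rewrite mul0r /rnorm normr0.
rewrite !inE => -[linf [M Mf]] [ling [N Ng]]; split=> [b x y|].
  by rewrite !fctE /= linf ling !scalerDr !scalerA (mulrC b) addrACA.
exists (rnorm (a : R[i]^o) * M + N) => x.
rewrite (le_trans (ler_rnormD _ _))// rnormZ mulrDl lerD// -mulrA.
by rewrite ler_wpM2l ?rnorm_ge0.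
Qed.

HB.instance Definition _ :=
  GRing.isSubmodClosed.Build R[i] (E -> F) bounded_pred bounded_submod_closed.
HB.instance Definition _ := [SubChoice_isSubLmodule of blop by <:].

Definition opnorm (f : blop) : R :=
  sup [set rnorm (f x) | x in [set x : E | rnorm x <= 1]].

Lemma blop0 (f : blop) : f 0 = 0.
Proof.
have [linf _] := boundedP f.
have := linf 1 0 0; rewrite !scale1r addr0 => /eqP.
by rewrite eq_sym -subr_eq0 addrK => /eqP.
Qed.

Lemma blopZ (f : blop) a x : f (a *: x) = a *: f x.
Proof.
have [linf _] := boundedP f.
by have := linf a x 0; rewrite !addr0 blop0 addr0.
Qed.

Lemma opnorm_has_sup (f : blop) :
  has_sup [set rnorm (f x) | x in [set x : E | rnorm x <= 1]].
Proof.
split; first by exists (rnorm (f 0)), 0 => //=; rewrite /rnorm normr0.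
have [_ [M Mf]] := boundedP f; exists `|M| => _ [x /= x1 <-].
rewrite (le_trans (Mf x))// (le_trans (ler_wpM2r _ (ler_norm M))) ?rnorm_ge0//.
by rewrite ler_piMr.
Qed.

Lemma rnorm_blop (f : blop) x : rnorm (f x) <= opnorm f * rnorm x.
Proof.
have [x0|x0] := eqVneq x 0; first by rewrite x0 blop0 /rnorm !normr0 mulr0.
have rx0 : 0 < rnorm x by rewrite -ltcR -rnormE normr_gt0.
rewrite -ler_pdivrMr//.
have -> : rnorm (f x) / rnorm x = rnorm (f (((rnorm x)^-1)%:C *: x)).
  rewrite blopZ rnormZ mulrC; congr (_ * _).
  by rewrite /rnorm normc_def /= expr0n addr0 sqrtr_sqr ger0_norm// invr_ge0 ltW.
apply: (sup_upper_bound (opnorm_has_sup f)); eexists => //=.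
rewrite rnormZ /rnorm [X in X * _](_ : _ = (rnorm x)^-1) ?mulVf ?gt_eqF//.
by rewrite normc_def /= expr0n addr0 sqrtr_sqr ger0_norm// invr_ge0 ltW.
Qed.

Lemma opnorm_le (f : blop) M : (forall x, rnorm x <= 1 -> rnorm (f x) <= M) ->
  opnorm f <= M.
Proof.
move=> fM; apply: ge_sup; first by case: (opnorm_has_sup f).
by move=> _ [x /= x1 <-]; exact: fM.
Qed.

Lemma opnorm_ge0 (f : blop) : 0 <= opnorm f.
Proof.
apply: le_trans (rnorm_ge0 (f 0)) _.
apply: (sup_upper_bound (opnorm_has_sup f)); exists 0 => //=.
by rewrite /rnorm normr0.
Qed.

Let normB (f : blop) : R[i] := (opnorm f)%:C.

Let normB_triangle (f g : blop) : normB (f + g) <= normB f + normB g.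
Proof.
rewrite -rmorphD lecR; apply: opnorm_le => x x1.
rewrite (le_trans (ler_rnormD (f x) (g x)))// lerD//.
  by rewrite (le_trans (rnorm_blop f x))// ler_piMr ?opnorm_ge0.
by rewrite (le_trans (rnorm_blop g x))// ler_piMr ?opnorm_ge0.
Qed.

Let normBZ_le a (f : blop) :
  opnorm (a *: f) <= rnorm (a : R[i]^o) * opnorm f.
Proof.
apply: opnorm_le => x x1; rewrite [_ x]/(a *: f x) rnormZ ler_wpM2l ?rnorm_ge0//.
by rewrite (le_trans (rnorm_blop f x))// ler_piMr ?opnorm_ge0.
Qed.

Let normBZ (a : R[i]) (f : blop) : normB (a *: f) = `|a| * normB f.
Proof.
have -> : `|a| = (rnorm (a : R[i]^o))%:C by rewrite -rnormE.
rewrite -rmorphM; congr (_%:C); apply/eqP; rewrite eq_le normBZ_le /=.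
have [->|a0] := eqVneq a 0.
  by rewrite {1}/rnorm normr0 mul0r opnorm_ge0.
have ra0 : 0 < rnorm (a : R[i]^o) by rewrite -ltcR -rnormE normr_gt0.
rewrite -ler_pdivlMl//; have := normBZ_le a^-1 (a *: f).
rewrite scalerA mulVf// scale1r => /le_trans; apply.
by rewrite {1}/rnorm normfV -/(rnorm _) rnormE -fmorphV.
Qed.

Let normB_eq0 (f : blop) : normB f = 0 -> f = 0.
Proof.
move=> [f0]; apply/val_inj/funext => x /=.
have := rnorm_blop f x; rewrite f0 mul0r => fx.
apply/eqP; rewrite -normr_eq0 rnormE; apply/eqP; congr (_%:C).
by apply/eqP; rewrite eq_le fx rnorm_ge0.
Qed.

HB.instance Definition _ := Lmodule_isNormed.Build R[i] blop
  normB_triangle normBZ normB_eq0.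

End BoundedOperators.

(* The circle carries the topology induced by R[i] and its Borel
   sigma-algebra. *)
Definition circle (R : realType) : Type :=
  set_type [set z : R[i]^o | `|z| = 1].

Section Circle.
Context (R : realType).

HB.instance Definition _ :=
  Topological.copy (circle R) (set_type [set z : R[i]^o | `|z| = 1]).

Lemma expi_subproof (t : R) :
  (cos t +i* sin t : R[i]) \in [set z : R[i]^o | `|z| = 1].
Proof. by rewrite inE /= normc_def /= cos2Dsin2 sqrtr1. Qed.

Definition expi (t : R) : circle R := 
  exist (fun z : R[i] => z \in [set z : R[i]^o | `|z| = 1]) _ (expi_subproof t).

HB.instance Definition _ := isPointed.Build (circle R) (expi 0).

HB.instance Definition _ := Measurable.copy (circle R)
  (g_sigma_algebraType (@open (circle R))).

(* normalized arc length dt / 2pi under t |-> e^{it}, t in [0, 2pi[ *)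
Definition haar (A : set (circle R)) : \bar R :=
  (((2 * pi)^-1)%:E * lebesgue_measure (`[0%R, (2 * pi)%R[ `&` expi @^-1` A))%E.

Definition phi_ (k : int) (z : circle R) : R[i]^o := (\val z : R[i]) ^ k.

End Circle.

Section VectorMeasures.
Context (R : realType) (E : normedModType R[i]).
Implicit Types (mu : set (circle R) -> E) (B : set (circle R)).

(* A measure is a function on all sets; only its values on Borel sets are used
   or constrained. *)
Definition countably_additive mu :=
  forall F : nat -> set (circle R), (forall i, measurable (F i)) ->
    trivIset setT F ->
    \sum_(0 <= i < n) mu (F i) @[n --> \oo] --> mu (\bigcup_i F i).

Definition total_variation (nu : set (circle R) -> R[i]^o) B : \bar R :=
  ereal_sup [set v | exists n (F : 'I_n -> set (circle R)),
    [/\ forall i, measurable (F i), trivIset setT F, \bigcup_i F i = B &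
        v = (\sum_i rnorm (nu (F i)))%:E]].

(* If E = 0 there is no e with `|e| = 1 and the supremum is -oo. *)
Definition semivariation mu B : \bar R :=
  ereal_sup [set total_variation (fun A => e (mu A)) B |
             e in [set e : blop E R[i]^o | `|e| = 1]].

Definition regular_measure mu :=
  forall (eps : R) B, 0 < eps -> measurable B ->
    exists K O : set (circle R),
      [/\ compact K, open O, K `<=` B, B `<=` O &
          (semivariation mu (O `\` K) < eps%:E)%E].

Definition vmeasure mu := countably_additive mu /\ regular_measure mu.

Definition simple_fun (s : circle R -> R[i]^o) :=
  finite_set (range s) /\ forall c, measurable (s @^-1` [set c]).

Definition simple_integral mu (s : circle R -> R[i]^o) : E :=
  \sum_(c \in range s) c *: mu (s @^-1` [set c]).

(* The integral of simple functions extended by uniform limits, in particular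
   to continuous functions.  When E is complete and mu is a vector measure, a
   uniform limit phi of simple functions has exactly one v with
   [is_integral mu phi v]. *)
Definition is_integral mu (phi : circle R -> R[i]^o) (v : E) :=
  forall s : nat -> circle R -> R[i]^o, (forall n, simple_fun (s n)) ->
    {uniform, s @ \oo --> phi} ->
    simple_integral mu (s n) @[n --> \oo] --> v.

Definition vintegral mu (phi : circle R -> R[i]^o) : E :=
  get (is_integral mu phi).

Definition fourier mu (k : int) : E := vintegral mu (@phi_ R k).

Definition Vinfty mu := vmeasure mu /\
  exists2 C : R, 0 < C &
    forall A, measurable A -> ((rnorm (mu A))%:E <= C%:E * haar A)%E.

Definition Vinfty_norm mu : R :=
  sup [set rnorm (mu A) / fine (haar A) |
       A in [set A | measurable A /\ (0 < haar A)%E]].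

End VectorMeasures.

(* Matrices are indexed by {0, 1, ...} instead of {1, 2, ...}; only the
   differences k - j matter below. *)
Section Matrices.
Context (R : realType) (H : normedModType R[i]).
Implicit Types (A : nat -> nat -> blop H H) (x : nat -> H).

Definition toeplitz A := forall k j k' j' : nat,
  k%:Z - j%:Z = k'%:Z - j'%:Z -> A k j = A k' j'.

(* the norm of l^2(H), +oo outside l^2(H) *)
Definition l2norm x : \bar R := ('N[counting]_2%:E [ (fun j => (rnorm (x j))%:E) ])%E.

Definition c00 x := finite_set [set j | x j != 0].

Definition matrix_apply A x : nat -> H :=
  fun k => \sum_(j \in [set: nat]) A k j (x j).

Definition matrix_bound A (C : R) := 0 <= C /\
  forall x, c00 x -> (l2norm (matrix_apply A x) <= C%:E * l2norm x)%E.

Definition matrix_bounded A := exists C, matrix_bound A C.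

Definition matrix_norm A : R := inf [set C | matrix_bound A C].

End Matrices.

Definition separable (T : topologicalType) :=
  exists D : set T, countable D /\ dense D.

Definition hilbert_dot (R : realType) (H : completeNormedModType R[i])
  (dot : {dot H for Num.conj}) := forall x : H, `|x| ^+ 2 = dot x x.

(* Main.v *)
Require Import Defs.
From HB Require Import structures.
From mathcomp Require Import all_boot all_order all_algebra.
From mathcomp Require Import complex.
From mathcomp Require Import all_classical all_reals all_analysis.
From mathcomp Require Import ring lra zify.

(* Write [T l] for the common entry of a Toeplitz matrix at [j - k = l].  For a
   trigonometric polynomial [f = sum_l a_l z^l] put [Phi T f = sum_l a_l T_l].
   Testing the matrix on the vectors [(z^-q x)_q] bounds its Fejer sums by the
   matrix bound [C]; averaging them against [f] over the [L]-th roots of unity,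
   for which orthogonality is exact, and letting [L], then the order of the
   Fejer sum, tend to infinity gives [|Phi T f| <= C |f|_1].  Every Borel set is
   approximated by trigonometric polynomials with values in [[0, 1]], so the
   operators [Phi T f] converge as [f] tends to the indicator of [B]; the limit
   is [mu B], and [|mu B| <= C m(B)].
   Conversely, if [|mu B| <= M m(B)], a Riemann sum over the [L] arcs starting
   at the roots of unity writes the truncated matrix product as a discrete
   Fourier transform of the vectors [mu(I_i) X(zeta_i)], [X] being the discrete
   Fourier transform of [x]; applying Parseval's identity in [H] twice gives the
   bound [M].  The same Riemann sums show that the Fourier coefficients
   determine [mu], whence the equality of norms. *)

Set Implicit Arguments.
Unset Strict Implicit.
Unset Printing Implicit Defensive.

Import Order.TTheory GRing.Theory Num.Theory.
Import numFieldNormedType.Exports.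

Local Open Scope classical_set_scope.
Local Open Scope ring_scope.
Local Open Scope complex_scope.

(** * Norms and operators *)

Section Rnorm.
Context (R : realType) (E : normedZmodType R[i]).
Implicit Types x y : E.

(** [fourier] integrates z^k without conjugation, so [Phi T f] is what the integral of f against the
    measure sought has to be. The L^1 norm never appears as an integral: it is replaced by e + K
    m(E), for an f that is at most K everywhere and at most e off E. This form suits the
    approximation of indicators, where f is only known to be at most 1 on a small exceptional set,
    and it gives convergence in operator norm directly, without weak limits. Vector integrals are
    defined by uniform limits of simple functions; they are compared with Riemann sums over L equal
    arcs starting at the L-th roots of unity. These points also carry the discrete orthogonality, so
    one discretisation links matrix, polynomials and measure. The estimates carry along only finite
    additivity and |mu B| <= M m(B); countable additivity and regularity follow from these two. *)

Lemma rnorm0 : rnorm (0 : E) = 0.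
Proof. by rewrite /rnorm normr0. Qed.

Lemma rnormN x : rnorm (- x) = rnorm x.
Proof. by rewrite /rnorm normrN. Qed.

Lemma rnormB_sym x y : rnorm (x - y) = rnorm (y - x).
Proof. by rewrite -rnormN opprB. Qed.

Lemma rnorm0_eq0 x : rnorm x = 0 -> x = 0.
Proof. by move=> x0; apply/eqP; rewrite -normr_eq0 rnormE x0. Qed.

Lemma ler_rnormB x y : rnorm (x - y) <= rnorm x + rnorm y.
Proof. by rewrite (le_trans (ler_rnormD _ _))// rnormN. Qed.

Lemma ler_rnorm_dist x y : rnorm x <= rnorm y + rnorm (x - y).
Proof. by rewrite -{1}(subrK y x) addrC (le_trans (ler_rnormD _ _)). Qed.

Lemma ler_dist_rnorm x y : `|rnorm x - rnorm y| <= rnorm (x - y).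
Proof.
have h1 := ler_rnorm_dist x y; have h2 := ler_rnorm_dist y x.
rewrite (rnormB_sym y x) in h2.
by rewrite ler_norml; apply/andP; split; lra.
Qed.

Lemma ler_rnorm_sum (I : Type) (r : seq I) (P : pred I) (F : I -> E) :
  rnorm (\sum_(i <- r | P i) F i) <= \sum_(i <- r | P i) rnorm (F i).
Proof.
elim/big_ind2 : _ => [|x1 x2 y1 y2 h1 h2|//]; first by rewrite rnorm0.
by rewrite (le_trans (ler_rnormD _ _))// lerD.
Qed.

Lemma rnorm_lt x (e : R) : (`|x| < e%:C) = (rnorm x < e).
Proof. by rewrite rnormE ltcR. Qed.

End Rnorm.

Section RnormScalar.
Context (R : realType).
Implicit Types a b : R[i]^o.

Lemma rnormM a b : rnorm (a * b : R[i]^o) = rnorm a * rnorm b.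
Proof.
apply: (can_inj (f := real_complex R) (g := @complex.Re R)) => //.
by rewrite [RHS]rmorphM /= -!rnormE normrM.
Qed.

Lemma rnorm1 : rnorm (1 : R[i]^o) = 1.
Proof. by rewrite /rnorm normr1. Qed.

Lemma rnorm_real (x : R) : rnorm (x%:C : R[i]^o) = `|x|.
Proof. by rewrite /rnorm normc_def /= expr0n addr0 sqrtr_sqr. Qed.

Lemma rnorm_nat n : rnorm (n%:R : R[i]^o) = n%:R.
Proof. by rewrite -[n%:R](rmorph_nat (real_complex R)) rnorm_real ger0_norm. Qed.

Lemma rnormX a n : rnorm (a ^+ n : R[i]^o) = rnorm a ^+ n.
Proof. by elim: n => [|n ih]; rewrite ?expr0 ?rnorm1// !exprS rnormM ih. Qed.

Lemma rnormV a : rnorm (a^-1 : R[i]^o) = (rnorm a)^-1.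
Proof.
apply: (can_inj (f := real_complex R) (g := @complex.Re R)) => //.
by rewrite -rnormE normfV rnormE -fmorphV.
Qed.

Lemma ge0_rnormE a : 0 <= a -> a = (rnorm a)%:C.
Proof. by move=> a0; rewrite -rnormE ger0_norm. Qed.
End RnormScalar.

Section Convergence.
Context (R : realType) (E : normedModType R[i]).

Lemma complex_gt0_real (e : R[i]) : 0 < e -> exists2 r : R, 0 < r & e = r%:C.
Proof. by case: e => a b; rewrite ltcE /= => /andP[/eqP-> a0]; exists a. Qed.

Lemma cvg_rnormP (u : nat -> E) (l : E) :
  u n @[n --> \oo] --> l <->
  forall e : R, 0 < e -> \forall n \near \oo, rnorm (l - u n) < e.
Proof.
split=> [/cvgrPdist_lt h e e0|h].
  have := h e%:C; rewrite ltcR => /(_ e0).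
  by apply: filterS => n; rewrite rnorm_lt.
apply/cvgrPdist_lt => _ /complex_gt0_real[e e0 ->].
by have := h _ e0; apply: filterS => n; rewrite rnorm_lt.
Qed.

Lemma nbhs_rnormP (x : E) (A : set E) :
  nbhs x A <-> exists2 e : R, 0 < e & forall y, rnorm (x - y) < e -> A y.
Proof.
rewrite -nbhs_ballE; split.
  move=> [_ /complex_gt0_real[e e0 ->] h]; exists e => // y xy.
  by apply: h; rewrite -ball_normE /ball_ /= rnorm_lt.
move=> [e e0 h]; exists e%:C; first by rewrite /= ltcR.
by move=> y; rewrite -ball_normE /ball_ /= rnorm_lt; exact: h.
Qed.

Lemma rnorm_cvg_le (u : nat -> E) (l : E) (c : R) :
  u n @[n --> \oo] --> l -> (\forall n \near \oo, rnorm (u n) <= c) ->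
  rnorm l <= c.
Proof.
move=> /cvg_rnormP ul uc; apply/ler_addgt0Pr => e e0.
have [n _ ] := filterI uc (ul _ e0) => /(_ n (leqnn _)) /= [h1 h2].
by rewrite (le_trans (ler_rnorm_dist l (u n)))// lerD// ltW.
Qed.

End Convergence.

Section Completeness.
Context (R : realType).

Definition rcauchy (E : normedModType R[i]) (u : nat -> E) := forall e : R, 0 < e ->
  exists N, forall n m, (N <= n)%N -> (N <= m)%N -> rnorm (u n - u m) <= e.

Definition rcomplete (E : normedModType R[i]) := forall u : nat -> E,
  rcauchy u -> exists l : E, u n @[n --> \oo] --> l.

Lemma completeNormedMod_rcomplete (E : completeNormedModType R[i]) : rcomplete E.
Proof.
move=> u h.
have : cauchy (u @ \oo).
  apply/cauchy_ballP => _ /complex_gt0_real[e e0 ->].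
  have [N hN] := h _ (divr_gt0 e0 (@ltr0Sn _ 1)).
  exists (u @` [set n | (N <= n)%N], u @` [set n | (N <= n)%N]).
    by split; exists N => // n /= Nn; exists n.
  move=> [_ _] [/= [n Nn <-] [m Nm <-]].
  by rewrite -ball_normE /ball_ /= rnorm_lt (le_lt_trans (hN _ _ Nn Nm))//
    ltr_pdivrMr// ltr_pMr// ltr1n.
move=> /cauchy_cvg/cvg_ex[l ul]; by exists l.
Qed.

Lemma rnorm_blop_le (E F : normedModType R[i]) (f : blop E F) x :
  rnorm (f x) <= rnorm f * rnorm x.
Proof. exact: rnorm_blop. Qed.

Lemma rnorm_le_blop (E F : normedModType R[i]) (f : blop E F) (M : R) :
  0 <= M -> (forall x, rnorm (f x) <= M * rnorm x) -> rnorm f <= M.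
Proof.
move=> M0 h; apply: opnorm_le => x x1.
by rewrite (le_trans (h x))// ler_piMr.
Qed.

Lemma blopZl (E F : normedModType R[i]) (f : blop E F) (a : R[i]) x : (a *: f) x = a *:
  f x.
Proof. by []. Qed.
Lemma blop_sumE (E F : normedModType R[i]) I (r : seq I) P (f : I -> blop E F) x :
  (\sum_(i <- r | P i) f i) x = \sum_(i <- r | P i) f i x.
Proof. by apply: (big_morph (fun g : blop E F => g x)). Qed.
Lemma blopDr (E F : normedModType R[i]) (f : blop E F) x y : f (x + y) = f x + f y.
Proof.
have [lf _] := boundedP f.
by have := lf 1 x y; rewrite !scale1r.
Qed.
Lemma blop_sumr (E F : normedModType R[i]) I (r : seq I) P (f : blop E F) (x : I -> E) :
  f (\sum_(i <- r | P i) x i) = \sum_(i <- r | P i) f (x i).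
Proof. by apply: (big_morph f); [exact: blopDr|exact: blop0]. Qed.

Lemma blop_rcomplete (E F : normedModType R[i]) :
  rcomplete F -> rcomplete (blop E F).
Proof.
move=> cF u h.
have ux x : exists y : F, u n x @[n --> \oo] --> y.
  apply: cF => e e0.
  have d0 : 0 < rnorm x + 1 by rewrite ltr_wpDl ?rnorm_ge0.
  have [N hN] := h _ (divr_gt0 e0 d0).
  exists N => n m Nn Nm; rewrite -[u n x - u m x]/((u n - u m) x).
  rewrite (le_trans (rnorm_blop_le _ _))//.
  rewrite (le_trans (ler_wpM2r (rnorm_ge0 _) (hN _ _ Nn Nm)))//.
  by rewrite mulrAC ler_pdivrMr// ler_wpM2l ?(ltW e0)// lerDl.
pose f x := sval (cid (ux x)).
have fE x : u n x @[n --> \oo] --> f x by exact: (svalP (cid (ux x))).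
(* The estimate is uniform in x: it yields the boundedness of the limit as well as the convergence
   in operator norm. *)
have ue (e : R) : 0 < e -> exists N, forall n, (N <= n)%N -> forall x, rnorm (f x - u n
  x) <= e * rnorm x.
  move=> e0; have [N hN] := h _ e0; exists N => n Nn x.
  apply: (@rnorm_cvg_le _ _ (fun m => u m x - u n x)).
    by apply: cvgB; [exact: fE|exact: cvg_cst].
  exists N => // m /= Nm; rewrite -[_ - _]/((u m - u n) x).
  by rewrite (le_trans (rnorm_blop_le _ _))// ler_wpM2r ?rnorm_ge0// hN.
have fb : f \in @bounded_pred R E F.
  rewrite inE; split.
    move=> a x y.
    have hl := fE (a *: x + y).
    have hr : u n (a *: x + y) @[n --> \oo] --> a *: f x + f y.
      under eq_fun do rewrite blopDr blopZ.
      by apply: cvgD; [apply: cvgZr; exact: fE|exact: fE].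
    exact: (cvg_unique (@norm_hausdorff _ _) hl hr).
  have [N hN] := ue 1 ltr01; exists (opnorm (u N) + 1) => x.
  rewrite (le_trans (ler_rnorm_dist _ (u N x)))// mulrDl lerD ?hN//.
  exact: rnorm_blop.
exists (Blop fb); apply/cvg_rnormP => e e0.
have e20 : 0 < e / 2 by rewrite divr_gt0.
have [N hN] := ue _ e20; exists N => // n /= Nn.
apply: (@le_lt_trans _ _ (e / 2)); last by rewrite ltr_pdivrMr// ltr_pMr// ltr1n.
apply: rnorm_le_blop; first exact: ltW.
by move=> x; exact: hN.
Qed.
End Completeness.

(** * The circle *)

Section CircleParam.
Context (R : realType).
Implicit Types (s t : R) (z w : circle R).

Definition cval z : R[i]^o := \val z.

Lemma cval_expi t : cval (expi t) = cos t +i* sin t.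
Proof. by []. Qed.

Lemma norm_cval z : `|cval z| = 1.
Proof. by have := svalP z; rewrite inE. Qed.

Lemma rnorm_cval z : rnorm (cval z) = 1.
Proof. by rewrite /rnorm norm_cval. Qed.

Lemma cval_neq0 z : cval z != 0.
Proof. by rewrite -normr_eq0 norm_cval oner_neq0. Qed.

Lemma cval_inj : injective cval.
Proof. exact: val_inj. Qed.

Lemma expiD s t : cval (expi (s + t)) = cval (expi s) * cval (expi t).
Proof.
by rewrite !cval_expi /= sinD cosD; apply/eqP; rewrite eq_complex /= eqxx /= addrC eqxx.
Qed.

Lemma expi0 : cval (expi (0 : R)) = 1.
Proof. by rewrite cval_expi cos0 sin0. Qed.

Lemma expi_surj z : exists2 t, 0 <= t < 2 * pi & expi t = z.
Proof.
have pi0 : 0 < pi :> R by exact: pi_gt0.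
have : `|cval z| = 1 by exact: norm_cval.
case E : (cval z) => [a b]; rewrite normc_def /= => -[/(congr1 (fun x => x ^+ 2))].
rewrite sqr_sqrtr ?addr_ge0 ?sqr_ge0// expr1n => ab.
have a1 : -1 <= a <= 1.
  by rewrite -ler_norml -(@expr_le1 _ 2)// real_normK ?num_real// -ab lerDl sqr_ge0.
have cosa : cos (acos a) = a by rewrite acosK// in_itv.
have sina : sin (acos a) = `|b| by rewrite sin_acos// -ab addrC addKr sqrtr_sqr.
have [b0|b0] := leP 0 b.
  exists (acos a).
    rewrite acos_ge0//= (le_lt_trans (acos_lepi a1))//; lra.
  by apply: cval_inj; rewrite cval_expi cosa sina ger0_norm.
exists (2 * pi - acos a).
  have : 0 < acos a.
    rewrite lt_neqAle acos_ge0// andbT; apply/eqP => a0.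
    by move: sina; rewrite -a0 sin0 => /esym/eqP; rewrite normr_eq0 (lt_eqF b0).
  have := acos_lepi a1; lra.
apply: cval_inj; rewrite cval_expi E; congr (_ +i* _).
  by rewrite (_ : 2 * pi - acos a = - acos a + pi *+ 2) ?cosD2pi ?cosN ?cosa//; ring.
rewrite (_ : 2 * pi - acos a = - acos a + pi *+ 2) ?sinD2pi ?sinN ?sina//; last by ring.
by rewrite ltr0_norm// opprK.
Qed.

(** Cosine is injective only on [0, pi]; beyond pi the angle is reflected to 2 pi - |t|. *)
Lemma cos_eq1_lt2pi t : `|t| < 2 * pi -> cos t = 1 -> t = 0.
Proof.
move=> t2 ct; apply/eqP; rewrite -normr_eq0; apply/eqP.
rewrite -cos_norm in ct; move: (`|t|) (normr_ge0 t) t2 ct => u u0 u2 cu.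
have pi0 : 0 < pi :> R by exact: pi_gt0.
have [upi|piu] := leP u pi.
  by apply: (@cos_inj R); rewrite ?in_itv/= ?u0 ?lexx ?pi_ge0 ?upi// cu cos0.
suff : 2 * pi - u = 0 by lra.
apply: (@cos_inj R); rewrite ?in_itv/= ?lexx ?pi_ge0//; last first.
  by rewrite (_ : 2 * pi - u = - u + pi *+ 2) ?cosD2pi ?cosN ?cu ?cos0//; ring.
by apply/andP; split; lra.
Qed.

Lemma expi_inj s t : 0 <= s < 2 * pi -> 0 <= t < 2 * pi -> expi s = expi t -> s = t.
Proof.
move=> s2 t2 /(congr1 cval); rewrite !cval_expi => -[cst sst].
apply/eqP; rewrite -subr_eq0; apply/eqP; apply: cos_eq1_lt2pi.
  by rewrite ltr_norml; lra.
by rewrite cosB cst sst -!expr2 cos2Dsin2.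
Qed.

Lemma expi_2pi_nat (k : nat) : cval (expi (2 * pi * k%:R)) = 1.
Proof.
elim: k => [|k ih]; first by rewrite mulr0 expi0.
rewrite -[k.+1%:R]natr1 mulrDr mulr1 expiD ih mul1r cval_expi.
by rewrite mulr_natl cos2pi sin2pi.
Qed.

Lemma expiX t n : cval (expi (n%:R * t)) = cval (expi t) ^+ n.
Proof.
elim: n => [|n ih]; first by rewrite mul0r expi0 expr0.
by rewrite -[n.+1%:R]natr1 mulrDl mul1r expiD ih exprSr.
Qed.

Lemma lipschitz_of_derive (f df : R -> R) :
  (forall x : R, is_derive x (1 : R) f (df x)) -> (forall x, `|df x| <= 1) ->
  forall s t, `|f s - f t| <= `|s - t|.
Proof.
move=> fd df1; suff h s t : s <= t -> `|f s - f t| <= `|s - t|.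
  move=> s t; have [/h//|/ltW/h] := leP s t.
  by rewrite distrC (distrC t).
move=> st.
have [|c _] := @MVT_segment R f df s t st (fun x _ => fd x).
  apply: continuous_subspaceT => x.
  apply: differentiable_continuous; apply/derivable1_diffP.
  exact: (@ex_derive _ _ _ _ _ _ _ (fd x)).
rewrite distrC => ->; rewrite normrM (distrC s) ler_piMl//.
Qed.

Lemma rnorm_reim (a b : R) : rnorm (a +i* b : R[i]^o) <= `|a| + `|b|.
Proof.
rewrite /rnorm normc_def /=.
rewrite -(@ger0_norm _ (`|a| + `|b|)) ?addr_ge0// -sqrtr_sqr ler_sqrt ?sqr_ge0//.
by rewrite -(real_normK (num_real a)) -(real_normK (num_real b)) sqrrD lerD2r lerDl
  mulrn_wge0 ?mulr_ge0.
Qed.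

(** The constant 2 adds the Lipschitz constants of cosine and sine; it turns the length 2 pi / L
    into 4 pi / L in [arc_diam]. *)
Lemma expi_lipschitz s t : rnorm (cval (expi s) - cval (expi t)) <= 2 * `|s - t|.
Proof.
rewrite !cval_expi (le_trans (rnorm_reim _ _))// mulrDl mul1r lerD//.
  apply: (@lipschitz_of_derive cos (fun x => - sin x)) => x.
  by rewrite normrN sin_max.
by apply: (@lipschitz_of_derive sin cos) => x; rewrite cos_max.
Qed.

Lemma continuous_expi : continuous (@expi R).
Proof.
move=> t A [_ [/= [B oB <-] Bt] BA].
apply: (@filterS _ (nbhs t) _ (fun s => B (cval (expi s)))).
  by move=> s /BA.
have : nbhs (cval (expi t)) B by exact: open_nbhs_nbhs.
move=> /nbhs_rnormP[e e0 eB].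
have e20 : 0 < e / 2 by rewrite divr_gt0.
apply/nbhs_ballP; exists (e / 2) => // s /= ts.
apply: eB; rewrite (le_lt_trans (expi_lipschitz _ _))//.
by move: ts; rewrite -ball_normE /= ltr_pdivlMr// mulrC.
Qed.

Lemma continuous_cval : continuous cval.
Proof. exact: (@initial_continuous _ _ set_val). Qed.

Lemma hausdorff_circle : hausdorff_space (circle R).
Proof.
move=> z w zw; apply: cval_inj; apply: (@norm_hausdorff R[i] R[i]^o).
move=> A B Az Bw.
have [u [Au Bu]] := zw _ _ (continuous_cval Az) (continuous_cval Bw).
by exists (cval u).
Qed.

Lemma measurable_open_circle (A : set (circle R)) : open A -> measurable A.
Proof. by move=> oA; apply: sub_sigma_algebra. Qed.

Lemma measurable_closed_circle (A : set (circle R)) : closed A -> measurable A.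
Proof.
move=> cA; rewrite -(setCK A); apply: measurableC; apply: measurable_open_circle.
exact: closed_openC.
Qed.

Lemma measurable_compact_circle (A : set (circle R)) : compact A -> measurable A.
Proof.
by move=> /(compact_closed hausdorff_circle) /measurable_closed_circle.
Qed.

Lemma measurable_expi : measurable_fun [set: R] (@expi R).
Proof.
apply: (@measurability _ _ _ _ _ _ (@open (circle R))) => //.
move=> _ [A oA <-]; rewrite setTI; apply: measurable_realfun.open_measurable.
by apply: open_comp => // t _; exact: continuous_expi.
Qed.

End CircleParam.

(** * Haar measure and arcs *)

Section Haar.
Context (R : realType).
Implicit Types (A B : set (circle R)).

Let pi2_gt0 : 0 < 2 * pi :> R.
Proof. by rewrite mulr_gt0// pi_gt0. Qed.

Let measurable_preim A : measurable A -> measurable (`[0%R, (2 * pi)%R[ `&` @expi R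
  @^-1` A).
Proof.
move=> mA; apply: measurableI; first exact: measurable_itv.
by rewrite -[X in measurable X]setTI; exact: measurable_expi.
Qed.

Lemma haar0 : haar (@set0 (circle R)) = 0%E.
Proof. by rewrite /haar preimage_set0 setI0 measure0 mule0. Qed.

Lemma haar_ge0 A : (0 <= haar A)%E.
Proof. by rewrite mule_ge0// lee_fin invr_ge0 ltW. Qed.

Lemma haar_semi_sigma_additive : semi_sigma_additive (@haar R).
Proof.
move=> F mF tF mUF; rewrite /haar.
under eq_fun do rewrite -ge0_sume_distrr//.
apply: cvgeZl => //; rewrite preimage_bigcup setI_bigcupr.
apply: measure_semi_sigma_additive => [i||].
- exact: measurable_preim.
- apply: trivIset_setIl; apply/trivIsetP => /= i j _ _ ij; rewrite -preimage_setI.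
  by move/trivIsetP : tF => /(_ _ _ _ _ ij) ->//; rewrite preimage_set0.
- by apply: bigcup_measurable => k _; exact: measurable_preim.
Qed.

HB.instance Definition _ := isMeasure.Build _ _ _ (@haar R)
  haar0 haar_ge0 haar_semi_sigma_additive.

Lemma haarT : haar [set: circle R] = 1%E.
Proof.
rewrite /haar preimage_setT setIT lebesgue_measure_itv/= lte_fin pi2_gt0.
by rewrite sube0 -EFinM mulVf// gt_eqF.
Qed.

Definition haarR A : R := fine (haar A).

Lemma haarE A : measurable A -> haar A = (haarR A)%:E.
Proof.
move=> mA; rewrite /haarR fineK// ge0_fin_numE ?haar_ge0//.
apply: (@le_lt_trans _ _ (haar [set: circle R])); last by rewrite haarT ltry.
by apply: le_measure; rewrite ?inE.
Qed.

Lemma haarR_ge0 A : 0 <= haarR A.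
Proof. by rewrite fine_ge0 ?haar_ge0. Qed.

Lemma haarR0 : haarR set0 = 0.
Proof. by rewrite /haarR haar0. Qed.

Lemma haarRT : haarR setT = 1.
Proof. by rewrite /haarR haarT. Qed.

Lemma le_haarR A B : measurable A -> measurable B -> A `<=` B -> haarR A <= haarR B.
Proof.
by move=> mA mB AB; rewrite -lee_fin -!haarE//; apply: le_measure; rewrite ?inE.
Qed.

Lemma haarRU A B : measurable A -> measurable B -> A `&` B = set0 ->
  haarR (A `|` B) = haarR A + haarR B.
Proof.
move=> mA mB AB; apply: EFin_inj; rewrite EFinD -!haarE//; last exact: measurableU.
exact: measureU.
Qed.

Lemma le_haarRU A B : measurable A -> measurable B -> haarR (A `|` B) <= haarR A +
  haarR B.
Proof.
move=> mA mB; have mBA : measurable (B `\` A) by exact: measurableD.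
rewrite (_ : A `|` B = A `|` (B `\` A)).
  by rewrite haarRU// ?setDIK// lerD2l le_haarR.
by rewrite setUDr// setDv setD0 // setUC.
Qed.

Lemma le_haarR_bigU (I : Type) (r : seq I) (F : I -> set (circle R)) :
  (forall i, measurable (F i)) ->
  measurable (\big[setU/set0]_(i <- r) F i) /\
  haarR (\big[setU/set0]_(i <- r) F i) <= \sum_(i <- r) haarR (F i).
Proof.
move=> mF; elim: r => [|i r [ih1 ih2]]; first by rewrite !big_nil haarR0.
rewrite !big_cons; split; first exact: measurableU.
by rewrite (le_trans (le_haarRU _ _))// lerD2l.
Qed.

Lemma haarR_cvg0 (F : nat -> set (circle R)) : (forall n, measurable (F n)) ->
  nonincreasing_seq F -> \bigcap_n F n = set0 ->
  forall e, 0 < e -> exists n, haarR (F n) <= e.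
Proof.
move=> mF niF F0 e e0.
have := @nonincreasing_cvg_mu _ _ _ (@haar R) F.
rewrite F0 measure0 => /(_ _ mF measurable0 niF).
have -> : (haar (F 0%N) < +oo)%E by rewrite haarE// ltry.
move=> /(_ isT) /fine_cvgP[_ /cvgrPdist_lt/(_ _ e0)[n _ /(_ n (leqnn _))]].
by rewrite /= sub0r normrN ger0_norm ?haarR_ge0// => /ltW; exists n.
Qed.

(** Finite additivity is enough to work with: under domination by Haar measure,
    [bounded_countably_additive] recovers countable additivity. Values in any [zmodType] let [haarR]
    itself be an instance. *)
Definition fin_additive (E : zmodType) (mu : set (circle R) -> E) :=
  mu set0 = 0 /\ forall A B, measurable A -> measurable B -> A `&` B = set0 ->
    mu (A `|` B) = mu A + mu B.

Lemma fin_additive_haarR : fin_additive haarR.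
Proof. by split; [exact: haarR0|exact: haarRU]. Qed.

Lemma fin_additive_bigU (E : zmodType) (mu : set (circle R) -> E)
    (I : choiceType) (P : I -> set (circle R)) (s : seq I) :
  fin_additive mu -> (forall i, measurable (P i)) ->
  (forall i j, i != j -> P i `&` P j = set0) -> uniq s ->
  measurable (\big[setU/set0]_(i <- s) P i) /\
  mu (\big[setU/set0]_(i <- s) P i) = \sum_(i <- s) mu (P i).
Proof.
move=> [mu0 muU] mP dP.
elim: s => [|i s ih] /=; first by rewrite !big_nil.
move=> /andP[si /ih[ih1 ih2]]; rewrite !big_cons; split; first exact: measurableU.
rewrite muU ?ih2//.
rewrite -bigcup_seq; apply/seteqP; split => // z [Piz [j /= sj Pjz]].
have ij : i != j by apply: contraNneq si => ->.
by have : (P i `&` P j) z by []; rewrite (dP _ _ ij).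
Qed.

Lemma fin_additive_partition (E : zmodType) (mu : set (circle R) -> E)
    (I : finType) (P : I -> set (circle R)) B :
  fin_additive mu -> measurable B -> (forall i, measurable (P i)) ->
  (forall i j, i != j -> P i `&` P j = set0) -> (forall z, exists i, P i z) ->
  mu B = \sum_i mu (B `&` P i).
Proof.
move=> amu mB mP dP cP.
have mBP i : measurable (B `&` P i) by exact: measurableI.
have dBP i j : i != j -> B `&` P i `&` (B `&` P j) = set0.
  by move=> ij; rewrite setIACA dP ?setI0.
have [_ <-] := fin_additive_bigU amu mBP dBP (index_enum_uniq I).
congr mu; rewrite -[RHS]bigcup_seq; apply/seteqP; split => z.
  by move=> Bz; have [i Pi] := cP z; exists i => //=; rewrite mem_index_enum.
by move=> [i _ []].
Qed.

End Haar.

Section Arcs.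
Context (R : realType).
Implicit Types (A B : set (circle R)).

Let pi2_gt0 : 0 < 2 * pi :> R.
Proof. by rewrite mulr_gt0// pi_gt0. Qed.

(** A half-open interval is not compact, but it is a countable union of segments, whose images are
    compact and hence Borel. *)
Lemma measurable_expi_itv (a b : R) : measurable (@expi R @` `[a, b[).
Proof.
rewrite (_ : _ @` _ = \bigcup_n (@expi R @` `[a, b - n.+1%:R^-1])).
  apply: bigcup_measurable => n _; apply: measurable_compact_circle.
  apply: continuous_compact; last exact: segment_compact.
  by apply: continuous_subspaceT => t; exact: continuous_expi.
apply/seteqP; split => [_ [t /= + <-]|_ [n _ [t /= + <-]]];
  rewrite in_itv/= => /andP[at_ tb]; last first.
  exists t => //=; rewrite in_itv/= at_/= (le_lt_trans tb)// ltrBlDr ltrDl invr_gt0.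
  by rewrite ltr0n.
have bt0 : 0 < b - t by rewrite subr_gt0.
have [n] := ltr_add_invr bt0.
rewrite add0r => h.
exists n => //; exists t => //=; rewrite in_itv/= at_/= lerBrDr addrC -lerBrDr.
exact: ltW.
Qed.

Lemma haarR_expi_itv (a b : R) : 0 <= a -> a < b -> b <= 2 * pi ->
  haarR (@expi R @` `[a, b[) = (2 * pi)^-1 * (b - a).
Proof.
move=> a0 ab b2; rewrite /haarR /haar (_ : _ `&` _ = `[a, b[%classic).
  by rewrite lebesgue_measure_itv/= lte_fin ab.
apply/seteqP; split => [t [/=]|t /=]; rewrite in_itv/= => /andP[at_ tb].
  move=> [s]; rewrite in_itv/= => /andP[as_ sb] st.
  suff -> : t = s by rewrite in_itv/= as_.
  apply: expi_inj => //; first by rewrite at_.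
  by rewrite (le_trans a0 as_) (lt_le_trans sb).
rewrite in_itv/= (le_trans a0)//= (lt_le_trans tb)//; split => //.
by exists t; rewrite //= in_itv/= at_.
Qed.

(** Both the i-th power of a primitive L-th root of unity and the left end of [carc L i], so that
    orthogonality and Riemann sums use the same points. *)
Definition zeta (L i : nat) : circle R := expi (2 * pi / L%:R * i%:R).
Definition carc (L i : nat) : set (circle R) :=
  @expi R @` `[2 * pi / L%:R * i%:R, 2 * pi / L%:R * i.+1%:R[.

Section L.
Context (L : nat) (L0 : (0 < L)%N).

Let h0 : 0 < 2 * pi / L%:R :> R.
Proof. by rewrite divr_gt0// ltr0n. Qed.

Lemma measurable_arc i : measurable (carc L i).
Proof. exact: measurable_expi_itv. Qed.

Lemma haarR_arc i : (i < L)%N -> haarR (carc L i) = L%:R^-1.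
Proof.
move=> iL; rewrite haarR_expi_itv.
- rewrite -mulrBr -(natrB _ (leqnSn i)) subSnn mulr1 mulrA mulVf ?mul1r// gt_eqF//.
- by rewrite mulr_ge0// ltW.
- by rewrite ltr_pM2l// ltr_nat.
- by rewrite mulrAC ler_pdivrMr ?ltr0n// ler_pM2l// ler_nat.
Qed.

Lemma arc_cover z : exists i : 'I_L, carc L i z.
Proof.
have [t /andP[t0 t2] <-] := expi_surj z.
pose x := t / (2 * pi / L%:R).
have x0 : 0 <= x by rewrite divr_ge0// ltW.
have xt : t = 2 * pi / L%:R * x by rewrite /x mulrCA divff ?mulr1// gt_eqF.
have /andP[tr1 tr2] := Num.Theory.truncn_itv x0.
have iL : (Num.truncn x < L)%N.
  rewrite -(ltr_nat R) (le_lt_trans tr1)// /x ltr_pdivrMr// mulrCA divff ?mulr1//.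
  by rewrite gt_eqF// ltr0n.
exists (Ordinal iL); exists t => //=; rewrite in_itv/= xt.
by rewrite ler_pM2l// ltr_pM2l// tr1.
Qed.

Lemma arc_disjoint (i j : 'I_L) : i != j -> carc L i `&` carc L j = set0.
Proof.
move=> ij; rewrite -subset0 => _ [[t /= ti <-] [s /= sj st]].
have in02 k (u : R) : (k < L)%N -> u \in `[2 * pi / L%:R * k%:R, (2 * pi / L%:R *
  k.+1%:R)%R[ ->
    0 <= u < 2 * pi.
  move=> kL; rewrite in_itv/= => /andP[u1 u2].
  have u0 : 0 <= u by rewrite (le_trans _ u1)// mulr_ge0// ltW.
  rewrite u0 /= (lt_le_trans u2)//.
  by rewrite mulrAC ler_pdivrMr ?ltr0n// ler_pM2l// ler_nat.
have {}st : s = t by apply: expi_inj => //; [exact: in02 sj|exact: in02 ti].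
move: ti sj; rewrite st !in_itv/= => /andP[i1 i2] /andP[j1 j2].
move: (le_lt_trans i1 j2) (le_lt_trans j1 i2).
rewrite !ltr_pM2l// !ltr_nat !ltnS => h1 h2.
by move/eqP: ij; apply; apply/val_inj/eqP; rewrite /= eqn_leq h1.
Qed.

Lemma arc_partition (E : zmodType) (mu : set (circle R) -> E) B :
  fin_additive mu -> measurable B -> mu B = \sum_(i < L) mu (B `&` carc L i).
Proof.
move=> amu mB; apply: fin_additive_partition => //.
- by move=> i; exact: measurable_arc.
- exact: arc_disjoint.
- exact: arc_cover.
Qed.

Lemma arc_diam i z : carc L i z ->
  rnorm (cval z - cval (zeta L i)) <= 4 * pi / L%:R.
Proof.
move=> [t /= + <-]; rewrite in_itv/= => /andP[t1 t2].
rewrite (le_trans (expi_lipschitz _ _))//.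
rewrite ger0_norm ?subr_ge0//.
have : t - 2 * pi / L%:R * i%:R <= 2 * pi / L%:R.
  by rewrite lerBlDr (le_trans (ltW t2))// -[i.+1%:R]natr1 mulrDr mulr1 addrC.
lra.
Qed.

Lemma zetaX i k : (cval (zeta L i)) ^+ (L * k) = 1.
Proof.
rewrite -expiX natrM /= (_ : _ * _ * _ = 2 * pi * (k * i)%N%:R) ?expi_2pi_nat//.
by rewrite natrM; field; rewrite pnatr_eq0 -lt0n.
Qed.

Lemma zeta_mul i : cval (zeta L i) = cval (zeta L 1) ^+ i.
Proof. by rewrite -expiX /zeta mulr1 mulrC. Qed.

Lemma zeta1_eq1 i : (i < L)%N -> cval (zeta L i) = 1 -> i = 0%N.
Proof.
move=> iL; rewrite -expi0 => /cval_inj/expi_inj => h.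
have : 2 * pi / L%:R * i%:R = 0 :> R.
  apply: h; last by rewrite lexx.
  have -> : 0 <= 2 * pi / L%:R * i%:R :> R by rewrite mulr_ge0// ltW.
  by rewrite /= mulrAC ltr_pdivrMr ?ltr0n// ltr_pM2l// ltr_nat.
by move/eqP; rewrite mulf_eq0 (gt_eqF h0)/= pnatr_eq0 => /eqP.
Qed.

End L.
End Arcs.

(** * Matrices on l^2(H) *)

Section L2.
Context (R : realType) (H : normedModType R[i]).
Implicit Types (A : nat -> nat -> blop H H) (x : nat -> H).

Lemma l2normE x :
  l2norm x = ((\sum_(0 <= k <oo) (rnorm (x k) ^+ 2)%:E) `^ 2^-1)%E.
Proof.
rewrite /l2norm Lnorm_counting//; congr (_ `^ _)%E; apply: eq_eseriesr => k _.
by rewrite abse_EFin poweR_EFin ger0_norm ?rnorm_ge0// powR_mulrn ?rnorm_ge0.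
Qed.

(** Bounding all truncations replaces the infinite sum, so that later estimates stay among finite
    real sums; the exponent 1/2 is removed by monotonicity of powers. *)
Lemma l2norm_leP x (a : R) : 0 <= a ->
  (l2norm x <= a%:E)%E <-> forall n, \sum_(k < n) rnorm (x k) ^+ 2 <= a ^+ 2.
Proof.
move=> a0; rewrite l2normE.
have s0 : (0 <= \sum_(0 <= k <oo) (rnorm (x k) ^+ 2)%:E)%E.
  by apply: nneseries_ge0 => k _ _; rewrite lee_fin sqr_ge0.
have -> : ((\sum_(0 <= k <oo) (rnorm (x k) ^+ 2)%:E) `^ 2^-1 <= a%:E)%E =
  (\sum_(0 <= k <oo) (rnorm (x k) ^+ 2)%:E <= (a ^+ 2)%:E)%E.
  move: (\sum_(0 <= k <oo) _)%E s0 => S S0.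
  apply/idP/idP => h.
    have -> : S = ((S `^ 2^-1) `^ 2)%E by rewrite -poweRrM mulVf// poweRe1.
    have -> : ((a ^+ 2)%:E = (a%:E `^ 2))%E by rewrite poweR_EFin powR_mulrn.
    by apply: gt0_ler_poweR => //; rewrite in_itv/= leey andbT ?poweR_ge0 ?lee_fin.
  have -> : (a%:E = (a ^+ 2)%:E `^ 2^-1)%E.
    by rewrite poweR_EFin powR12_sqrt ?sqr_ge0// sqrtr_sqr ger0_norm.
  by apply: gt0_ler_poweR => //; rewrite in_itv/= leey andbT// lee_fin sqr_ge0.
split.
  move=> h n; rewrite -lee_fin -sumEFin (le_trans _ h)//.
  rewrite -(big_mkord xpredT (fun k => (rnorm (x k) ^+ 2)%:E)).
  by apply: nneseries_lim_ge => k _ _; rewrite lee_fin sqr_ge0.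
move=> h; apply: lime_le.
  by apply: is_cvg_nneseries => k _ _; rewrite lee_fin sqr_ge0.
by apply: nearW => n; rewrite sumEFin lee_fin big_mkord.
Qed.

Lemma l2norm_fin n x : (forall j, (n <= j)%N -> x j = 0) ->
  l2norm x = (Num.sqrt (\sum_(j < n) rnorm (x j) ^+ 2))%:E.
Proof.
move=> x0; rewrite l2normE (nneseries_split 0 n); last first.
  by move=> k _; rewrite lee_fin sqr_ge0.
rewrite add0n eseries0 ?adde0; last first.
  by move=> k nk _; rewrite x0// rnorm0 expr0n.
rewrite sumEFin poweR_EFin big_mkord powR12_sqrt// sumr_ge0// => k _.
exact: sqr_ge0.
Qed.

Lemma c00_bound x : c00 x -> exists n, forall j, (n <= j)%N -> x j = 0.
Proof.
move=> /finite_seqP[X xX]; exists (\max_(i <- X) i).+1 => j nj.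
apply/eqP; apply: contraTT nj => xj; rewrite -ltnNge ltnS.
have jX : j \in X by have : [set` X] j by rewrite -xX.
by rewrite (big_rem _ jX)/= leq_maxl.
Qed.

Lemma matrix_applyE A n x : (forall j, (n <= j)%N -> x j = 0) ->
  forall k, matrix_apply A x k = \sum_(j < n) A k j (x j).
Proof.
move=> x0 k; rewrite /matrix_apply (fsbig_ord _ n (fun j => A k j (x j))).
apply/esym/fsbig_widen => // j [_ /= /negP]; rewrite -leqNgt => nj.
by rewrite x0// blop0.
Qed.

(** A finitely supported input amounts to its first n entries, and the norm of the output to its
    truncations to m rows, with n and m independent. *)
Lemma matrix_boundP A (C : R) : matrix_bound A C <-> 0 <= C /\
  forall n m x, \sum_(k < m) rnorm (\sum_(j < n) A k j (x j)) ^+ 2 <=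
    C ^+ 2 * \sum_(j < n) rnorm (x j) ^+ 2.
Proof.
split=> -[C0 h]; split => //.
  move=> n m x; pose y j := if (j < n)%N then x j else 0.
  have yx (j : 'I_n) : y j = x j by rewrite /y ltn_ord.
  have y0 j : (n <= j)%N -> y j = 0 by rewrite /y ltnNge => ->.
  have cy : c00 y.
    apply: (@sub_finite_set _ _ `I_n) => // j /=; apply: contraNT.
    by rewrite -leqNgt => /y0 ->.
  have := h _ cy; rewrite (l2norm_fin y0) -EFinM => /l2norm_leP.
  rewrite mulr_ge0 ?sqrtr_ge0// => /(_ isT m).
  rewrite exprMn sqr_sqrtr; last by rewrite sumr_ge0// => k _; exact: sqr_ge0.
  under eq_bigr do rewrite (matrix_applyE _ y0).
  under eq_bigr => k _ do under eq_bigr do rewrite yx.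
  by under [X in _ <= _ * X -> _]eq_bigr do rewrite yx.
move=> x /c00_bound[n x0]; rewrite (l2norm_fin x0) -EFinM.
apply/l2norm_leP; first by rewrite mulr_ge0 ?sqrtr_ge0.
move=> m; rewrite exprMn sqr_sqrtr; last by rewrite sumr_ge0// => k _; exact: sqr_ge0.
by under eq_bigr do rewrite (matrix_applyE _ x0).
Qed.

End L2.

(** * Trigonometric polynomials *)

Section Characters.
Context (R : realType).
Implicit Types (z w : circle R) (k l : int).

Lemma phi_exp k z : phi_ k z = (cval z : R[i]) ^ k.
Proof. by []. Qed.

Lemma phi0 z : phi_ 0 z = 1.
Proof. by []. Qed.

Lemma phi_unit z : (cval z : R[i]) \is a GRing.unit.
Proof. by rewrite unitfE; exact: cval_neq0. Qed.

Lemma phiD k l z : phi_ (k + l) z = phi_ k z * phi_ l z.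
Proof. by rewrite !phi_exp expfzDr// cval_neq0. Qed.

Lemma phi_conj z : (cval z : R[i])^-1 = Num.conj (cval z : R[i]).
Proof.
apply: (mulfI (cval_neq0 z)); rewrite mulfV ?cval_neq0// -normCK.
by rewrite (norm_cval z) expr1n.
Qed.

Lemma rnorm_phi k z : rnorm (phi_ k z) = 1.
Proof.
rewrite phi_exp; case: k => n.
  by rewrite -exprnP rnormX rnorm_cval expr1n.
by rewrite NegzE -exprnN rnormV rnormX rnorm_cval expr1n invr1.
Qed.

Lemma rnormX_lipschitz (n : nat) (a b : R[i]^o) : rnorm a <= 1 -> rnorm b <= 1 ->
  rnorm (a ^+ n - b ^+ n) <= n%:R * rnorm (a - b).
Proof.
move=> a1 b1; elim: n => [|n ih]; first by rewrite !expr0 subrr rnorm0 mul0r.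
have -> : a ^+ n.+1 - b ^+ n.+1 = a * (a ^+ n - b ^+ n) + (a - b) * b ^+ n.
  by rewrite !exprS; ring.
rewrite (le_trans (ler_rnormD _ _))// !rnormM -natr1 mulrDl mul1r lerD//.
  by rewrite (le_trans _ ih)// ler_piMl ?rnorm_ge0.
by rewrite ler_piMr ?rnorm_ge0// rnormX exprn_ile1 ?rnorm_ge0.
Qed.

Lemma phi_lipschitz k z w :
  rnorm (phi_ k z - phi_ k w) <= `|k|%N%:R * rnorm (cval z - cval w).
Proof.
rewrite !phi_exp; case: k => n.
  by rewrite -!exprnP rnormX_lipschitz ?rnorm_cval.
rewrite NegzE -!exprnN -!exprVn (le_trans (rnormX_lipschitz _ _ _)) ?rnormV ?rnorm_cval
  ?invr1//.
rewrite abszN absz_nat ler_wpM2l//.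
have -> : (cval z)^-1 - (cval w)^-1 = (cval z)^-1 * (cval w)^-1 * (cval w - cval z).
  by field; rewrite !cval_neq0.
by rewrite !rnormM !rnormV !rnorm_cval invr1 !mul1r rnormB_sym.
Qed.

(** A geometric sum whose ratio is an L-th root of unity, different from 1 when 0 < |k| < L. This
    bound on |k| is what ties L to the frequencies in every later use. *)
Lemma sum_phi_zeta L k : (`|k| < L)%N ->
  \sum_(i < L) phi_ k (zeta R L i) = if k == 0 then L%:R else 0.
Proof.
move=> kL; have L0 : (0 < L)%N by exact: leq_ltn_trans kL.
case: eqP => [->|/eqP k0].
  by under eq_bigr do rewrite phi0; rewrite sumr_const card_ord.
pose x := phi_ k (zeta R L 1).
have phiE i : phi_ k (zeta R L i) = x ^+ i.
  by rewrite /x !phi_exp zeta_mul// [_ ^+ i in LHS]exprnP [RHS]exprnP exprzAC.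
have phiE' i : phi_ k (zeta R L i) = (if (0 <= k)%R then cval (zeta R L (`|k| * i))
    else (cval (zeta R L (`|k| * i)))^-1).
  rewrite phi_exp zeta_mul// [in RHS]zeta_mul// mulnC exprM.
  case: (k) => n; first by rewrite -exprnP.
  by rewrite NegzE -exprnN abszN absz_nat.
under eq_bigr do rewrite phiE.
have x1 : x != 1.
  apply/eqP; rewrite /x phiE' muln1 => h.
  have : cval (zeta R L `|k|) = 1.
    by case: ifP h => // _ /(congr1 GRing.inv); rewrite invrK invr1.
  by move/(zeta1_eq1 L0 kL)/eqP; rewrite absz_eq0 (negbTE k0).
apply: (mulfI (_ : x - 1 != 0)); first by rewrite subr_eq0.
rewrite mulr0 -subrX1 -phiE phiE' [(`|k| * L)%N]mulnC zeta_mul// exprM.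
have -> : cval (zeta R L 1) ^+ L = 1 by rewrite -[in X in _ ^+ X](muln1 L) zetaX.
by rewrite expr1n invr1 if_same subrr.
Qed.

(** The Fejer weights: the number of entries on the k-th diagonal of an n by n matrix. Truncated
    subtraction makes it vanish for |k| >= n. *)
Lemma count_diff (n : nat) k :
  (\sum_(p < n) \sum_(q < n) ((k + p%:Z - q%:Z)%R == 0%R :> int) = n - `|k|)%N.
Proof.
have h (m : nat) : (\sum_(p < n) (m <= p) = n - m)%N.
  elim: n => [|n ih]; first by rewrite big_ord0.
  by rewrite big_ord_recr/= ih; case: leqP => h; lia.
have s (j : int) : (\sum_(q < n) (j == q%:Z) = ((0 <= j) && (j < n%:Z))%R)%N.
  case: (boolP ((0 <= j) && (j < n%:Z))) => jn.
    have jn' : (`|j|%N < n)%N by lia.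
    rewrite (bigD1 (Ordinal jn'))//= big1 ?addn0; first by lia.
    by move=> q /eqP qj; case: eqP => // jq; case: qj; apply/val_inj; rewrite /= jq
      absz_nat.
  rewrite big1// => q _; case: eqP => // jq; by move: jn; rewrite jq le0z_nat ltz_nat
    ltn_ord.
case: k => k.
  have e (p q : nat) : (k%:Z + p%:Z - q%:Z == 0)%R = (q%:Z - k%:Z == p%:Z)%R.
    by apply/eqP/eqP; lia.
  rewrite exchange_big/= -[RHS]h; apply: eq_bigr => q _.
  under eq_bigr do rewrite e.
  by rewrite s; congr nat_of_bool; have := ltn_ord q; lia.
have e (p q : nat) : (Negz k + p%:Z - q%:Z == 0)%R = (p%:Z - k.+1%:Z == q%:Z)%R.
  by apply/eqP/eqP; lia.
rewrite -[RHS]h; apply: eq_bigr => p _.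
under eq_bigr do rewrite e.
by rewrite s; congr nat_of_bool; have := ltn_ord p; lia.
Qed.

End Characters.

Section Trig.
Context (R : realType).
Implicit Types (z w : circle R) (k l : int) (f g : seq (R[i] * int)).

(* Pairs (coefficient, frequency); frequencies may repeat, so that sums and
   products are formal and [Phi] is additive by construction. *)
Definition tev f z : R[i]^o := \sum_(p <- f) p.1 * phi_ p.2 z.

Definition Phi (E : lmodType R[i]) (T : int -> E) f : E :=
  \sum_(p <- f) p.1 *: T p.2.

Definition tscale (c : R[i]) f := [seq (c * p.1, p.2) | p <- f].
Definition tmul f g := [seq (p.1 * q.1, p.2 + q.2) | p <- f, q <- g].

Lemma tev_cat f g z : tev (f ++ g) z = tev f z + tev g z.
Proof. by rewrite /tev big_cat. Qed.

Lemma tev_scale c f z : tev (tscale c f) z = c * tev f z.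
Proof.
by rewrite /tev big_map big_distrr/=; apply: eq_bigr => p _; rewrite mulrA.
Qed.

Lemma tev_mul f g z : tev (tmul f g) z = tev f z * tev g z.
Proof.
rewrite /tev big_allpairs_dep/= big_distrl/=; apply: eq_bigr => p _.
by rewrite big_distrr/=; apply: eq_bigr => q _; rewrite phiD mulrACA.
Qed.

Lemma tev1 c k z : tev [:: (c, k)] z = c * phi_ k z.
Proof. by rewrite /tev big_seq1. Qed.

Section PhiLinear.
Context (E : lmodType R[i]) (T : int -> E).

Lemma Phi_cat f g : Phi T (f ++ g) = Phi T f + Phi T g.
Proof. by rewrite /Phi big_cat. Qed.

Lemma Phi_scale c f : Phi T (tscale c f) = c *: Phi T f.
Proof.
by rewrite /Phi big_map scaler_sumr; apply: eq_bigr => p _; rewrite scalerA.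
Qed.

Lemma Phi1 c k : Phi T [:: (c, k)] = c *: T k.
Proof. by rewrite /Phi big_seq1. Qed.

End PhiLinear.

Definition tlip f : R := \sum_(p <- f) rnorm (p.1 : R[i]^o) * `|p.2|%N%:R.

Lemma tlip_ge0 f : 0 <= tlip f.
Proof. by rewrite sumr_ge0// => p _; rewrite mulr_ge0 ?rnorm_ge0. Qed.

Lemma tev_lipschitz f z w :
  rnorm (tev f z - tev f w) <= tlip f * rnorm (cval z - cval w).
Proof.
rewrite /tev -sumrB (le_trans (ler_rnorm_sum _ _ _))// /tlip big_distrl/=.
apply: ler_sum => p _; rewrite -mulrBr rnormM -mulrA ler_wpM2l ?rnorm_ge0//.
exact: phi_lipschitz.
Qed.

Lemma tev_arc f L i z : (0 < L)%N -> @carc R L i z ->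
  rnorm (tev f z - tev f (zeta R L i)) <= tlip f * (4 * pi / L%:R).
Proof.
move=> L0 iz; rewrite (le_trans (tev_lipschitz _ _ _))// ler_wpM2l ?tlip_ge0//.
exact: arc_diam.
Qed.

Lemma mesh_lt (c e : R) : 0 < e -> exists2 N : nat, (0 < N)%N &
  forall L, (N <= L)%N -> c * (4 * pi / L%:R) <= e.
Proof.
move=> e0.
have [c0|c0] := leP c 0.
  exists 1%N => // L _; rewrite (le_trans _ (ltW e0))// mulr_le0_ge0//.
  by rewrite divr_ge0// mulr_ge0// pi_ge0.
have [N _ hN] := near_infty_natSinv_lt (PosNum (divr_gt0 e0 (mulr_gt0 c0 (mulr_gt0
  (ltr0n R 4) (pi_gt0 R))))).
exists N.+1 => // -[//|L] NL.
have := hN _ NL => /=; rewrite ltr_pdivlMr; last by rewrite !mulr_gt0// pi_gt0.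
have -> : c * (4 * pi / L.+1%:R) = L.+1%:R^-1 * (c * (4 * pi)) by ring.
exact: ltW.
Qed.

End Trig.

(** * Fejer sums and the L^1 bound for [Phi] *)

Lemma sum_sqr_ler (R : realType) (n : nat) (a : 'I_n -> R) :
  (\sum_i a i) ^+ 2 <= n%:R * \sum_i a i ^+ 2.
Proof.
elim: n a => [|n ih] a; first by rewrite !big_ord0 mul0r expr0n.
rewrite !big_ord_recr/=; set S := \sum_(i < n) _; set Q := \sum_(i < n) _.
have ihS : S ^+ 2 <= n%:R * Q by exact: ih.
move: (a ord_max) => b.
(* Expanding these squares bounds the cross term 2 S b of (S + b)^2 by Q + n b^2. *)
have : 0 <= \sum_(i < n) (a (widen_ord (leqnSn n) i) - b) ^+ 2.
  by rewrite sumr_ge0// => i _; exact: sqr_ge0.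
under eq_bigr do rewrite sqrrB.
rewrite big_split/= sumrB sumr_const card_ord sumrMnl -mulr_suml -/S -/Q.
rewrite -[b ^+ 2 *+ n]mulr_natl -[n.+1%:R]natr1 => h.
rewrite sqrrD; move: ihS h; move: (n%:R : R) => N; nra.
Qed.

Section Fejer.
Context (R : realType) (H : normedModType R[i]) (T : int -> blop H H) (C : R).
Hypothesis bT : matrix_bound (fun k j : nat => T (j%:Z - k%:Z)) C.

(** n times the Fejer mean of the formal series sum_l z^-l T_l: the coefficient of T_l adds up to (n
    - |l|) z^-l. The double sum keeps the n by n corner of the matrix visible. *)
Definition fejer n z : blop H H :=
  \sum_(p < n) \sum_(q < n) phi_ (p%:Z - q%:Z) z *: T (q%:Z - p%:Z).

(** The test vector has l^2 norm sqrt n |x|, and summing n unimodular multiples of the rows [v p]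
    costs another sqrt n by Cauchy-Schwarz. *)
Lemma rnorm_fejer n z : rnorm (fejer n z) <= n%:R * C.
Proof.
have [C0 hT] := (matrix_boundP _ _).1 bT.
apply: rnorm_le_blop => [|x]; first by rewrite mulr_ge0.
pose y (q : nat) : H := phi_ (- q%:Z) z *: x.
pose v (p : nat) : H := \sum_(q < n) T (q%:Z - p%:Z) (y q).
have -> : fejer n z x = \sum_(p < n) phi_ p%:Z z *: v p.
  rewrite blop_sumE; apply: eq_bigr => p _; rewrite blop_sumE scaler_sumr.
  by apply: eq_bigr => q _; rewrite blopZl /y blopZ scalerA phiD.
rewrite (le_trans (ler_rnorm_sum _ _ _))//.
under eq_bigr do rewrite rnormZ rnorm_phi mul1r.
have nCx : 0 <= n%:R * C * rnorm x by rewrite !mulr_ge0 ?rnorm_ge0.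
rewrite -(@ler_pXn2r _ 2) ?nnegrE ?sumr_ge0//; last by move=> *; exact: rnorm_ge0.
rewrite (le_trans (sum_sqr_ler _))//.
have := hT n n y.
under [X in _ <= _ * X -> _]eq_bigr do rewrite rnormZ rnorm_phi mul1r.
rewrite sumr_const card_ord -[_ *+ n]mulr_natl => h.
rewrite (le_trans (ler_wpM2l (ler0n _ n) h))//.
by rewrite le_eqVlt; apply/orP; left; apply/eqP; ring.
Qed.

(** For each frequency k of f, the mean over the roots of unity keeps the pairs with q - p = k,
    whose number is the Fejer weight. The frequencies met are k + p - q, of modulus below |k| + n,
    whence the hypothesis on L. *)
Lemma sum_fejer f n L :
  (forall p, p \in f -> (`|p.2| + n < L)%N) ->
  \sum_(i < L) tev f (zeta R L i) *: fejer n (zeta R L i) =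
  (L%:R : R[i]) *: \sum_(p <- f) (p.1 * (n - `|p.2|)%N%:R) *: T p.2.
Proof.
move=> fL; rewrite scaler_sumr.
under eq_bigr do rewrite /tev scaler_suml.
rewrite exchange_big/=; apply: eq_big_seq => -[a k] /fL /= kL.
under eq_bigr do rewrite -scalerA.
rewrite -scaler_sumr scalerA [L%:R * _]mulrCA -scalerA; congr (_ *: _).
under eq_bigr do rewrite scaler_sumr; rewrite exchange_big/=.
rewrite -count_diff -scalerA natr_sum scaler_suml scaler_sumr.
apply: eq_bigr => p _.
under eq_bigr do rewrite scaler_sumr; rewrite exchange_big/=.
rewrite natr_sum scaler_suml scaler_sumr; apply: eq_bigr => q _.
under eq_bigr do rewrite scalerA -phiD.
rewrite -scaler_suml sum_phi_zeta; last first.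
  by have := ltn_ord p; have := ltn_ord q; lia.
rewrite addrA scalerA; case: eqP => e; last by rewrite mulr0 !scale0r.
by rewrite mulr1; congr (_ *: T _); lia.
Qed.

(** Here e + K m(E) stands in for the L^1 norm, because a Riemann sum can be compared with it arc by
    arc. The mesh is refined for each fixed n before n grows, since L has to exceed n. *)
Lemma Phi_bound f (E : set (circle R)) (e K : R) :
  measurable E -> 0 <= e -> 0 <= K -> (forall z, rnorm (tev f z) <= K) ->
  (forall z, ~ E z -> rnorm (tev f z) <= e) ->
  rnorm (Phi T f) <= C * (e + K * haarR E).
Proof.
move=> mE e0 K0 fK fe; have C0 : 0 <= C by case: bT.
(* An arc contained in E is paid for by K m(E); any other arc has a point off E, and between that
   point and the root of unity f varies by at most d. *)
have riemann L : (0 < L)%N -> \sum_(i < L) rnorm (tev f (zeta R L i)) <=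
    L%:R * (e + tlip f * (4 * pi / L%:R) + K * haarR E).
  move=> L0; set d := tlip f * _; have Lr0 : 0 < L%:R :> R by rewrite ltr0n.
  have d0 : 0 <= d.
    by rewrite mulr_ge0 ?tlip_ge0// divr_ge0// mulr_ge0// pi_ge0.
  have hi (i : 'I_L) : rnorm (tev f (zeta R L i)) * L%:R^-1 <=
      (e + d) * L%:R^-1 + K * haarR (E `&` @carc R L i).
    have mi := measurable_arc (R:=R) L i; have mEi := measurableI _ _ mE mi.
    have [iE|/existsNP[z /not_implyP[iz Ez]]] := pselect (forall z, @carc R L i z -> E z).
      rewrite (le_trans (ler_wpM2r _ (fK _))) ?invr_ge0//.
      rewrite (_ : E `&` _ = @carc R L i) ?haarR_arc//.
        by rewrite lerDr mulr_ge0 ?addr_ge0 ?invr_ge0.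
      by apply/seteqP; split=> [z []//|z iz]; split => //; exact: iE.
    rewrite (@le_trans _ _ ((e + d) * L%:R^-1)) ?lerDl ?mulr_ge0 ?haarR_ge0//.
    rewrite ler_wpM2r ?invr_ge0//.
    rewrite (le_trans (ler_rnorm_dist _ (tev f z)))// lerD ?fe//.
    by rewrite rnormB_sym tev_arc.
  have := @ler_sum R _ (index_enum 'I_L) xpredT _ _ (fun i _ => hi i).
  rewrite -mulr_suml big_split/= sumr_const card_ord -mulr_sumr.
  rewrite -(arc_partition L0 (@fin_additive_haarR R) mE).
  rewrite -[_ / _ *+ L]mulr_natl mulrCA divff ?mulr1 ?gt_eqF//.
  by rewrite ler_pdivrMr// mulrC.
have cesaro n : (0 < n)%N ->
    rnorm (\sum_(p <- f) (p.1 * (n - `|p.2|)%N%:R) *: T p.2) <= n%:R * (C * (e + K *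
      haarR E)).
  move=> n0; apply/ler_addgt0Pr => d d0.
  have nC1 : 0 < n%:R * C + 1 by rewrite ltr_wpDl// mulr_ge0.
  have [N N0 hN] := mesh_lt (tlip f) (divr_gt0 d0 nC1).
  (* Beyond N for a small mesh, and beyond every |p.2| + n for orthogonality. *)
  pose L := (N + \max_(p <- f) `|p.2| + n).+1%N.
  have L0 : 0 < L%:R :> R by rewrite ltr0n.
  have := @sum_fejer f n L; move/(_ _)/(congr1 (@rnorm _ _)).
  rewrite rnormZ rnorm_nat => sfL.
  rewrite -(ler_pM2l L0) -sfL; last first.
    move=> p pf; rewrite /L ltnS leq_add2r (leq_trans _ (leq_addl _ _))//.
    by rewrite (big_rem _ pf)/= leq_maxl.
  rewrite (le_trans (ler_rnorm_sum _ _ _))//.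
  under eq_bigr do rewrite rnormZ.
  rewrite (@le_trans _ _ (\sum_(i < L) rnorm (tev f (zeta R L i)) * (n%:R * C)))//.
    by apply: ler_sum => i _; rewrite ler_wpM2l ?rnorm_ge0 ?rnorm_fejer.
  rewrite -mulr_suml (le_trans (ler_wpM2r _ (riemann L _))) ?mulr_ge0//.
  rewrite -[leLHS]mulrA ler_pM2l//.
  have : tlip f * (4 * pi / L%:R) <= d / (n%:R * C + 1).
    by apply: hN; rewrite /L -addnA -addnS leq_addr.
  rewrite ler_pdivlMr// => hd.
  have t0 : 0 <= tlip f * (4 * pi / L%:R).
    by rewrite mulr_ge0 ?tlip_ge0// divr_ge0// mulr_ge0// pi_ge0.
  by move: hd t0; move: (tlip f * _) => t hd t0; lra.
(* The weight n - |k| misses n by at most |k| for every n; divided by n, this error vanishes. *)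
have dist n : (0 < n)%N -> rnorm (Phi T f) <= C * (e + K * haarR E) +
   n%:R^-1 * (\sum_(p <- f) rnorm (p.1 : R[i]^o) * `|p.2|%N%:R * rnorm (T p.2)).
  move=> n0; have nr0 : 0 < n%:R :> R by rewrite ltr0n.
  rewrite -(ler_pM2l nr0) mulrDr [n%:R * (n%:R^-1 * _)]mulrA divff ?gt_eqF// mul1r.
  rewrite -[X in X * rnorm _]rnorm_nat -rnormZ.
  rewrite (le_trans (ler_rnorm_dist _ (\sum_(p <- f) (p.1 * (n - `|p.2|)%N%:R) *: T
    p.2)))//.
  rewrite lerD ?cesaro// /Phi scaler_sumr -sumrB (le_trans (ler_rnorm_sum _ _ _))//.
  apply: ler_sum => p _; rewrite scalerA -scalerBl rnormZ.
  rewrite ler_wpM2r ?rnorm_ge0// mulrC -mulrBr rnormM ler_wpM2l ?rnorm_ge0//.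
  rewrite -(natrB _ (leq_subr _ _)) rnorm_nat ler_nat; lia.
apply/ler_addgt0Pr => d d0.
set S := \sum_(p <- f) rnorm (p.1 : R[i]^o) * `|p.2|%N%:R * rnorm (T p.2) in dist.
have S1 : 0 < S + 1.
  by rewrite ltr_wpDl// sumr_ge0// => p _; rewrite !mulr_ge0 ?rnorm_ge0.
have [N _ /(_ N (leqnn N)) /= hN] := near_infty_natSinv_lt (PosNum (divr_gt0 d0 S1)).
rewrite (le_trans (dist N.+1 isT))// lerD2l.
have N0 : 0 < N.+1%:R^-1 :> R by rewrite invr_gt0.
move: hN; rewrite ltr_pdivlMr// mulrDr mulr1 => /ltW; apply: le_trans.
by rewrite lerDl ltW.
Qed.

End Fejer.

(** * Approximation of Borel sets *)

Section StepApprox.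
Context (R : realType).

Lemma bernoulli_onem (y : R) n : 0 <= y <= 1 -> 1 - n%:R * y <= (1 - y) ^+ n.
Proof.
move=> /andP[y0 y1]; elim: n => [|n ih]; first by rewrite mul0r subr0 expr0.
rewrite exprS -natr1; have := ler_wpM2l (_ : 0 <= 1 - y) ih.
rewrite subr_ge0 => /(_ y1); apply: le_trans.
have : 0 <= n%:R * y * y by rewrite !mulr_ge0.
by move: (n%:R : R) => N; nra.
Qed.

Lemma bernoulli_onep (y : R) n : 0 <= y -> 1 + n%:R * y <= (1 + y) ^+ n.
Proof.
move=> y0; elim: n => [|n ih]; first by rewrite mul0r addr0 expr0.
rewrite exprS -natr1; have := ler_wpM2l (_ : 0 <= 1 + y) ih.
rewrite addr_ge0// => /(_ isT); apply: le_trans.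
have : 0 <= n%:R * y * y by rewrite !mulr_ge0.
by move: (n%:R : R) => N; nra.
Qed.

Lemma onem_exp_le (y : R) n : 0 <= y <= 1 -> (1 - y) ^+ n * (1 + n%:R * y) <= 1.
Proof.
move=> /andP[y0 y1].
rewrite (le_trans (ler_wpM2l _ (bernoulli_onep n y0))) ?exprn_ge0 ?subr_ge0//.
rewrite -exprMn (_ : (1 - y) * (1 + y) = 1 - y ^+ 2); last by ring.
by rewrite exprn_ile1 ?subr_ge0 ?lerBlDr ?lerDl ?sqr_ge0// exprn_ile1.
Qed.

(* For [x >= 1/2] the exponent [2 ^ n * s] makes the power at most
   [1 / (1 + s)]; below [1/2] it is at least [1 - s (2 x) ^ n]. *)
Lemma step_approx (e eta : R) : 0 < e -> 0 < eta -> exists n N,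
  forall x : R, 0 <= x <= 1 -> [/\ 0 <= (1 - x ^+ n) ^+ N <= 1,
    (2^-1 <= x -> (1 - x ^+ n) ^+ N <= e) &
    (x <= 2^-1 - eta -> 1 - e <= (1 - x ^+ n) ^+ N)].
Proof.
move=> e0 eta0.
have [s _ /(_ s (leqnn s)) /= hs] := near_infty_natSinv_lt (PosNum e0).
(* Bounds 2 x for x <= 1/2 - eta; the maximum with 0 keeps q in [0, 1) when eta exceeds 1/2. *)
pose q := Num.max 0 (1 - 2 * eta).
have q0 : 0 <= q by rewrite le_max lexx.
have q1 : `|q| < 1 by rewrite ger0_norm// gt_max ltr01/= ltrBlDr ltrDl mulr_gt0.
have s0 : 0 < s.+1%:R :> R by rewrite ltr0n.
have := @cvg_expr R q q1 => /cvgrPdist_le/(_ _ (divr_gt0 e0 s0))[n _ /(_ n (leqnn n))].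
rewrite /= sub0r normrN ger0_norm ?exprn_ge0// => hq.
exists n, (2 ^ n * s.+1)%N => x /andP[x0 x1].
have xn : 0 <= x ^+ n <= 1 by rewrite exprn_ge0 ?exprn_ile1.
have xx : (2 ^ n * s.+1)%:R * x ^+ n = s.+1%:R * (2 * x) ^+ n.
  by rewrite exprMn natrM natrX; ring.
split.
- by rewrite exprn_ge0 ?exprn_ile1 ?subr_ge0 ?lerBlDr ?lerDl//; case/andP: xn.
- move=> x2; have := onem_exp_le (2 ^ n * s.+1) xn; rewrite xx.
  set p := _ ^+ (_ * _) => hp.
  have p0 : 0 <= p by rewrite exprn_ge0// subr_ge0; case/andP: xn.
  have x21 : 1 <= (2 * x) ^+ n by rewrite exprn_ege1//; lra.
  have : p * s.+1%:R <= 1.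
    rewrite (le_trans _ hp)// ler_wpM2l//.
    by rewrite (le_trans (ler_peMr (ltW s0) x21))// lerDr.
  rewrite -ler_pdivlMr// div1r => /le_trans; apply; exact: ltW.
- move=> x2; apply: le_trans (bernoulli_onem _ xn); rewrite xx lerD2l lerN2.
  rewrite mulrC -ler_pdivlMr//; apply: le_trans hq.
  rewrite lerXn2r ?nnegrE ?mulr_ge0// le_max; apply/orP; right; lra.
Qed.

End StepApprox.

Section Good.
Context (R : realType).
Implicit Types (z w : circle R) (B E : set (circle R)) (f g : seq (R[i] * int)).

Definition ind B z : R[i]^o := (z \in B)%:R.

(** Approximation in measure with a rate. Values in [0, 1], for the order of the complex numbers,
    make [tev f] real, bound it on the exceptional set E, and survive 1 - f and products, as
    complements and intersections require. *)
Definition tapprox B (e : R) f E := [/\ measurable E, haarR E <= e,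
  (forall z, 0 <= tev f z <= 1) &
  (forall z, ~ E z -> rnorm (tev f z - ind B z) <= e)].

Definition good B := forall e : R, 0 < e -> exists f E, tapprox B e f E.

Lemma rnorm01 (a : R[i]^o) : 0 <= a <= 1 -> rnorm a <= 1.
Proof.
move=> /andP[a0 a1]; rewrite -lecR -ge0_rnormE//.
Qed.

Lemma tapprox_le1 B e f E z : tapprox B e f E -> rnorm (tev f z) <= 1.
Proof. by case=> _ _ h _; exact: rnorm01. Qed.

Lemma good0 : good set0.
Proof.
move=> e e0; exists [::], set0; split => //; first by rewrite haarR0 ltW.
  by move=> z; rewrite /tev big_nil lexx ler01.
by move=> z _; rewrite /ind /tev big_nil in_set0 subr0 rnorm0 ltW.
Qed.

Lemma goodC B : good B -> good (~` B).
Proof.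
move=> gB e e0; have [f [E [mE hE f01 fE]]] := gB e e0.
exists ([:: (1, 0)] ++ tscale (-1) f), E.
have fz z : tev ([:: (1, 0)] ++ tscale (-1) f) z = 1 - tev f z.
  by rewrite tev_cat tev_scale tev1 phi0 mulr1 mulN1r.
split => // z; rewrite fz.
  by have /andP[h1 h2] := f01 z; rewrite subr_ge0 h2 lerBlDr lerDl.
move=> Ez; rewrite /ind in_setC.
have -> : 1 - tev f z - (z \notin B)%:R = - (tev f z - ind B z).
  by rewrite /ind; case: (z \in B) => /=; ring.
by rewrite rnormN fE.
Qed.

Lemma goodI A B : good A -> good B -> good (A `&` B).
Proof.
move=> gA gB e e0; have e20 : 0 < e / 2 by rewrite divr_gt0.
have [f [E [mE hE f01 fE]]] := gA _ e20.
have [g [F [mF hF g01 gF]]] := gB _ e20.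
exists (tmul f g), (E `|` F); split.
- exact: measurableU.
- by rewrite (le_trans (le_haarRU mE mF))// [leRHS](splitr e) lerD.
- move=> z; rewrite tev_mul; have /andP[h1 h2] := f01 z; have /andP[h3 h4] := g01 z.
  by rewrite mulr_ge0//= mulr_ile1.
- move=> z /not_orP[Ez Fz]; rewrite tev_mul.
  have -> : tev f z * tev g z - ind (A `&` B) z =
    (tev f z - ind A z) * tev g z + ind A z * (tev g z - ind B z).
    by rewrite /ind in_setI; case: (z \in A); case: (z \in B) => /=; ring.
  rewrite (le_trans (ler_rnormD _ _))// [leRHS](splitr e) !rnormM lerD//.
    by rewrite (le_trans _ (fE _ Ez))// ler_piMr ?rnorm_ge0 ?rnorm01.
  rewrite (le_trans _ (gF _ Fz))// ler_piMl ?rnorm_ge0//.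
  by rewrite /ind; case: (z \in A); rewrite ?rnorm1 ?rnorm0.
Qed.

Lemma good_of_tapprox B : (forall e : R, 0 < e -> exists B' D,
    [/\ good B', measurable D, haarR D <= e & forall z, ~ D z -> B' z <-> B z]) ->
  good B.
Proof.
move=> h e e0; have e20 : 0 < e / 2 by rewrite divr_gt0.
have [B' [D [gB' mD hD B'B]]] := h _ e20.
have [f [E [mE hE f01 fE]]] := gB' _ e20.
exists f, (E `|` D); split => //.
- exact: measurableU.
- by rewrite (le_trans (le_haarRU mE mD))// [leRHS](splitr e) lerD.
- move=> z /not_orP[Ez Dz].
  have -> : ind B z = ind B' z.
    by rewrite /ind; congr ((nat_of_bool _)%:R); apply/idP/idP; rewrite !inE => /(B'B _
      Dz).
  by rewrite (le_trans (fE _ Ez))// ler_pdivrMr// ler_peMr ?ltW// ltr1n.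
Qed.

(** Finite unions come from complements and intersections; what they miss of the whole union
    decreases to the empty set, so its measure tends to 0. *)
Lemma good_bigcup (F : nat -> set (circle R)) :
  (forall n, measurable (F n)) -> (forall n, good (F n)) -> good (\bigcup_n F n).
Proof.
move=> mF gF; apply: good_of_tapprox => e e0.
pose G n := \bigcup_(i < n) F i.
have mG n : measurable (G n) by apply: bigcup_measurable.
have gG n : good (G n).
  elim: n => [|n ih]; first by rewrite /G bigcup_mkord big_ord0; exact: good0.
  rewrite /G bigcup_mkord big_ord_recr/= -bigcup_mkord -/(G n).
  by rewrite -(setCK (_ `|` _)) setCU; apply: goodC; apply: goodI; apply: goodC.
pose D n := \bigcup_n F n `\` G n.
have mD n : measurable (D n).
  by apply: measurableD => //; apply: bigcup_measurable.
have [n hn] : exists n, haarR (D n) <= e.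
  apply: haarR_cvg0 => //.
    move=> n m nm; apply/subsetPset => z [Uz Gz]; split => // -[i /= ni Fi].
    by apply: Gz; exists i => //=; exact: leq_trans nm.
  rewrite -subset0 => z h; have [[i _ Fi] _] := h 0%N I.
  have [_] := h i.+1 I; apply; by exists i => /=.
exists (G n), (D n); split => // z Dz; split; first by case=> i _ Fi; exists i.
move=> Uz; apply: contrapT => Gz; exact: Dz.
Qed.

Fixpoint tpow f n := if n is n'.+1 then tmul f (tpow f n') else [:: (1, 0)].

Lemma tev_pow f n z : tev (tpow f n) z = tev f z ^+ n.
Proof.
elim: n => [|n ih] /=; first by rewrite tev1 phi0 mulr1 expr0.
by rewrite tev_mul ih exprS.
Qed.

Definition cball w (r : R) : set (circle R) := [set z | rnorm (cval z - cval w) < r].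

Lemma open_rnorm_preimage w (P : R -> Prop) :
  open P -> open [set z : circle R | P (rnorm (cval z - cval w))].
Proof.
move=> oP; rewrite openE => z /= Pz.
have : nbhs (rnorm (cval z - cval w)) P by exact: open_nbhs_nbhs.
move=> /nbhs_ballP[e /= e0 he].
apply: (@filterS _ (nbhs z) _ (fun u => rnorm (cval z - cval u) < e)).
  move=> u zu; apply: he; rewrite -ball_normE /=.
  apply: le_lt_trans zu; rewrite (le_trans (ler_dist_rnorm _ _))//.
  by rewrite opprB addrA subrK.
have : nbhs (cval z) [set u | rnorm (cval z - u) < e].
  by apply/nbhs_rnormP; exists e.
exact: continuous_cval.
Qed.

(** On the circle conjugation is inversion, so the squared distance to w is a trigonometric
    polynomial of degree one. This is why balls are the sets to start from. *)
Lemma rnorm_cvalB_sqr z w : (rnorm (cval z - cval w) ^+ 2)%:C =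
  2 - (cval w : R[i])^-1 * (cval z : R[i]) - (cval w : R[i]) * (cval z : R[i])^-1.
Proof.
rewrite rmorphXn/= -rnormE normCK rmorphB/= -!phi_conj.
have := cval_neq0 z; have := cval_neq0 w.
move: (cval z : R[i]) (cval w : R[i]) => a b b0 a0.
by field; rewrite a0 b0.
Qed.

(** The polynomials of [step_approx], known from elementary proofs of the Stone-Weierstrass theorem,
    are composed with a rescaled squared distance. Only a thin shell inside the ball escapes their
    control. *)
Lemma good_cball w (r : R) : 0 < r -> good (cball w r).
Proof.
(* Neither r^2 nor the squared distance, which is at most 4, exceeds M; hence x stays within 1/2 of
   1/2, and x < 1/2 exactly on the ball. *)
move=> r0; pose M : R := 4 + r ^+ 2.
have M0 : 0 < M by rewrite /M; nra.
pose x z : R := 2^-1 + (rnorm (cval z - cval w) ^+ 2 - r ^+ 2) / (2 * M).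
have d2 z : 0 <= rnorm (cval z - cval w) <= 2.
  rewrite rnorm_ge0 (le_trans (ler_rnormB _ _))// !rnorm_cval; lra.
have x01 z : 0 <= x z <= 1.
  have /andP[h1 h2] := d2 z; rewrite /x.
  have : `|(rnorm (cval z - cval w) ^+ 2 - r ^+ 2) / (2 * M)| <= 2^-1.
    have M20 : 0 < 2 * M by rewrite mulr_gt0.
    rewrite normrM normfV (gtr0_norm M20) ler_pdivrMr// mulrA mulVf// mul1r ler_norml /M.
    by apply/andP; split; nra.
  by rewrite ler_norml => /andP[h3 h4]; apply/andP; split; lra.
have xlt z : (x z < 2^-1) = (rnorm (cval z - cval w) < r).
  rewrite /x -ltrBrDl subrr pmulr_llt0 ?invr_gt0 ?mulr_gt0// subr_lt0.
  by rewrite ltr_pXn2r// nnegrE ?rnorm_ge0// ltW.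
pose c : R[i] := ((2 * M)^-1)%:C.
pose xf : seq (R[i] * int) := [:: ((2^-1 + (2 - r ^+ 2) / (2 * M))%:C, 0);
  (- c * (cval w : R[i])^-1, 1); (- c * (cval w : R[i]), -1)].
have xfE z : tev xf z = (x z)%:C.
  rewrite /tev !big_cons big_nil /= phi0 mulr1 addr0.
  have -> : (x z)%:C = (2^-1)%:C + ((rnorm (cval z - cval w) ^+ 2)%:C - (r ^+ 2)%:C) * c.
    by rewrite /x rmorphD rmorphM rmorphB.
  have -> : (2^-1 + (2 - r ^+ 2) / (2 * M))%:C = (2^-1)%:C + (2 - (r ^+ 2)%:C) * c.
    by rewrite rmorphD rmorphM rmorphB rmorph_nat.
  rewrite rnorm_cvalB_sqr !phi_exp expr1z exprN1.
  move: (cval z : R[i])^-1 (cval w : R[i])^-1 => zi wi.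
  by ring.
move=> e e0.
(* The shell where [step_approx] gives no estimate for eta = 1/(m+1). The shells decrease to the
   empty set, so one of them has measure at most e. *)
pose D m : set (circle R) := [set z | 2^-1 - m.+1%:R^-1 < x z < 2^-1].
have mD m : measurable (D m).
  apply: measurable_open_circle.
  apply: (@open_rnorm_preimage w (fun d => 2^-1 - m.+1%:R^-1 <
    2^-1 + (d ^+ 2 - r ^+ 2) / (2 * M) < 2^-1)).
  rewrite (_ : (fun _ => _) = (fun d : R => 2^-1 + (d ^+ 2 - r ^+ 2) / (2 * M)) @^-1`
    `]2^-1 - m.+1%:R^-1, 2^-1[%classic); last first.
    by apply/seteqP; split => d /=; rewrite in_itv.
  apply: open_comp; last exact: interval_open.
  move=> d _; apply: cvgD; first exact: cvg_cst.
  apply: cvgM; last exact: cvg_cst.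
  by apply: cvgB; [exact: exprn_continuous|exact: cvg_cst].
have [m hDm] : exists m, haarR (D m) <= e.
  apply: haarR_cvg0 => //.
    move=> i j ij; apply/subsetPset => z /= /andP[h1 h2]; rewrite /D /= h2 andbT.
    by rewrite (le_lt_trans _ h1)// lerB// lef_pV2 ?posrE// ler_nat.
  rewrite -subset0 => z h; have /andP[_ h2] := h 0%N I.
  have [k hk] := ltr_add_invr h2.
  by have /andP[h3 _] := h k I; move: h3 hk; rewrite ltrBlDr => h3 /lt_trans/(_ h3);
    rewrite ltxx.
have eta0 : 0 < m.+1%:R^-1 :> R by rewrite invr_gt0.
have [n [N hnN]] := step_approx e0 eta0.
pose f := tpow ([:: (1, 0)] ++ tscale (-1) (tpow xf n)) N.
have fE z : tev f z = ((1 - x z ^+ n) ^+ N)%:C.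
  rewrite /f tev_pow tev_cat tev_scale tev1 phi0 mulr1 mulN1r tev_pow xfE.
  by rewrite rmorphXn rmorphB rmorph1 rmorphXn.
exists f, (D m); split => // z; have [h1 h2 h3] := hnN _ (x01 z).
  by rewrite fE -(rmorph0 (real_complex R)) -(rmorph1 (real_complex R)) !lecR.
move=> Dz; rewrite fE /ind.
have -> : (z \in cball w r) = (x z < 2^-1).
  by rewrite xlt; apply/idP/idP; rewrite inE.
have -> : (((1 - x z ^+ n) ^+ N)%:C - (x z < 2^-1)%R%:R : R[i]^o) =
    ((1 - x z ^+ n) ^+ N - (x z < 2^-1)%R%:R)%:C.
  by rewrite rmorphB rmorph_nat.
rewrite rnorm_real; have [hx|] := boolP (x z < 2^-1) => /=; last rewrite -leNgt => hx.
  have : x z <= 2^-1 - m.+1%:R^-1.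
    by rewrite leNgt; apply: contra_notN Dz => h; rewrite /D /= h.
  by move=> /h3 h4; move: h1 => /andP[_ h1]; rewrite ler_norml; lra.
by rewrite subr0 ger0_norm ?h2//; case/andP: h1.
Qed.

(** Second countability: balls with centre exp(i q), q rational, and radius 1/(m+1). F enumerates
    them, with the empty set where the index codes no pair or the ball leaves O. *)
Lemma open_bigcup_cball (O : set (circle R)) : open O ->
  exists F : nat -> set (circle R), O = \bigcup_n F n /\
    forall n, F n = set0 \/ exists w, exists2 r, 0 < r & F n = cball w r.
Proof.
move=> oO.
pose b (p : rat * nat) := cball (expi (ratr p.1 : R)) p.2.+1%:R^-1.
pose F n : set (circle R) := if @unpickle (rat * nat)%type n is Some p then
  if pselect (b p `<=` O) then b p else set0 else set0.
exists F; split; last first.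
  move=> n; rewrite /F; case: unpickle => [p|]; last by left.
  by case: pselect => h; [right; exists (expi (ratr p.1)), p.2.+1%:R^-1|left].
apply/seteqP; split => z; last first.
  move=> [n _]; rewrite /F; case: unpickle => [p|] //.
  by case: pselect => // h /h.
move=> Oz; have : nbhs z O by exact: open_nbhs_nbhs.
move=> [_ [/= [B oB <-] Bz] BO].
have : nbhs (cval z) B by exact: open_nbhs_nbhs.
move=> /nbhs_rnormP[e e0 eB].
have [m _ /(_ m (leqnn m)) /= m_small] := near_infty_natSinv_lt (PosNum (divr_gt0 e0
  (ltr0n R 2))).
have m0 : 0 < m.+1%:R^-1 :> R by rewrite invr_gt0.
have [t _ tz] := expi_surj z.
(* Half the radius, to absorb the Lipschitz constant 2 of [expi]. *)
have [q] : exists q : rat, ratr q \in `]t, t + m.+1%:R^-1 / 2[.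
  by apply: rat_in_itvoo; rewrite ltrDl divr_gt0.
rewrite in_itv/= => /andP[q1 q2].
have zq : rnorm (cval z - cval (expi (ratr q : R))) < m.+1%:R^-1.
  rewrite -tz (le_lt_trans (expi_lipschitz _ _))// distrC ger0_norm ?subr_ge0 ?ltW//.
  by rewrite mulrC -ltr_pdivlMr// ltrBlDr addrC.
exists (pickle (q, m)); first exact: I.
rewrite /F pickleK; case: pselect => [bO|[]]; first by rewrite /b /cball /=.
move=> u; rewrite /b /cball /= => uq; apply: BO => /=; apply: eB.
rewrite -(subrKA (cval (expi (ratr q : R)))) (le_lt_trans (ler_rnormD _ _))//.
rewrite (splitr e) ltrD ?(lt_trans zq)//.
by rewrite rnormB_sym (lt_trans uq).
Qed.

Lemma measurable_good B : measurable B -> good B.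
Proof.
move=> mB; suff : measurable B /\ good B by case.
(* Measurability is kept next to goodness because [good_bigcup] asks for it. *)
pose G := [set A : set (circle R) | measurable A /\ good A].
suff : <<s @open (circle R) >> `<=` G by move=> /(_ _ mB).
apply: smallest_sub.
  split; first by split; [exact: measurable0|exact: good0].
    move=> A [mA gA]; rewrite setTD; split; [exact: measurableC|exact: goodC].
  move=> F FG; split; first by apply: bigcupT_measurable => n; case: (FG n).
  by apply: good_bigcup => n; case: (FG n).
move=> O oO; split; first exact: measurable_open_circle.
have [F [-> hF]] := open_bigcup_cball oO.
have mc w r : measurable (cball w r).
  apply: measurable_open_circle.
  apply: (@open_rnorm_preimage w (fun d => d < r)).
  exact: (@open_lt R r).
by apply: good_bigcup => n; have [->|[w [r r0 ->]]] := hF n => //;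
  [exact: good0|exact: good_cball].
Qed.

End Good.

(** * Integration against bounded vector measures *)

Section BoundedMeasure.
Context (R : realType) (E : normedModType R[i]).
Implicit Types (mu : set (circle R) -> E) (B : set (circle R)).

(** The working form of [Vinfty], with its constant explicit and allowed to be 0, as the least bound
    can be. [Vinfty_bounded] and [bounded_Vinfty] translate. *)
Definition bounded_measure mu (M : R) := [/\ fin_additive mu, 0 <= M &
  forall B, measurable B -> rnorm (mu B) <= M * haarR B].

Lemma countably_additive_fin mu : mu set0 = 0 -> countably_additive mu -> fin_additive mu.
Proof.
move=> mu0 cmu; split => // A B mA mB AB.
pose F n := if n is 0%N then A else if n is 1%N then B else set0.
have mF n : measurable (F n) by rewrite /F; case: n => [|[|n]] /=; [exact: mA|exact:
  mB|exact: measurable0].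
have tF : trivIset setT F.
  apply/trivIsetP => -[|[|i]] [|[|j]] _ _ //= _; rewrite ?setI0 ?set0I//.
  by rewrite setIC.
have := cmu F mF tF.
rewrite (_ : \bigcup_i F i = A `|` B); last first.
  apply/seteqP; split => z.
    by move=> [[|[|i]] _ //]; [left|right].
  by move=> [Az|Bz]; [exists 0%N|exists 1%N].
move=> h; apply: (cvg_unique (@norm_hausdorff _ _) h).
apply: cvg_near_cst.
exists 2%N => // -[//|[//|n]] _.
by rewrite big_nat_recl// big_nat_recl//= big1 ?addr0.
Qed.

Lemma Vinfty_bounded mu : Vinfty mu -> exists M, bounded_measure mu M.
Proof.
move=> [[cmu _] [C C0 h]].
have bmu B : measurable B -> rnorm (mu B) <= C * haarR B.
  by move=> mB; rewrite -lee_fin EFinM -haarE// h.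
exists C; split => //; last exact: ltW.
apply: countably_additive_fin => //; apply: rnorm0_eq0; apply/eqP.
by rewrite eq_le rnorm_ge0 andbT (le_trans (bmu _ measurable0))// haarR0 mulr0.
Qed.

Definition riemann mu (phi : circle R -> R[i]^o) L : E :=
  \sum_(i < L) phi (zeta R L i) *: mu (carc L i).

Lemma simple_integralE mu (s : circle R -> R[i]^o) : simple_fun s ->
  exists n (c : 'I_n -> R[i]^o),
  [/\ simple_integral mu s = \sum_j c j *: mu (s @^-1` [set c j]),
   forall i j, i != j -> s @^-1` [set c i] `&` s @^-1` [set c j] = set0 &
   forall z, exists j, (s @^-1` [set c j]) z].
Proof.
move=> [/finite_seqP[r0 rE] _]; pose r := undup r0.
have rE' : range s = [set` r] by rewrite rE; apply/seteqP; split => x /=; rewrite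
  mem_undup.
exists (size r), (fun j => r`_j); split.
- rewrite /simple_integral rE' -fsbig_seq ?undup_uniq//.
  by rewrite (big_nth 0) big_mkord.
- move=> i j ij; rewrite -subset0 => z [/= -> /eqP].
  by rewrite nth_uniq ?undup_uniq// => /eqP/val_inj/eqP; rewrite (negbTE ij).
- move=> z; have : [set` r] (s z) by rewrite -rE'; exists z.
  move=> /= zr; have zr' : (index (s z) r < size r)%N by rewrite index_mem.
  by exists (Ordinal zr'); rewrite /= nth_index.
Qed.

(** The fibres of s and the arcs are refined into one finite partition. Any point of a nonempty
    piece shows that the two coefficients there differ by at most d + w, and the pieces have total
    measure 1. *)
Lemma simple_riemann mu M (s phi : circle R -> R[i]^o) (L : nat) (d w : R) :
  bounded_measure mu M -> (0 < L)%N -> simple_fun s ->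
  (forall z, rnorm (s z - phi z) <= d) ->
  (forall (i : 'I_L) z, carc L i z -> rnorm (phi z - phi (zeta R L i)) <= w) ->
  rnorm (simple_integral mu s - riemann mu phi L) <= M * (d + w).
Proof.
move=> [amu M0 bmu] L0 ss sd pw.
have [n [c [-> dc cc]]] := simple_integralE mu ss.
pose S j := s @^-1` [set c j].
have mS j : measurable (S j) by case: ss => _; exact.
have mA (i : 'I_L) : measurable (carc (R:=R) L i) by exact: measurable_arc.
have -> : \sum_j c j *: mu (s @^-1` [set c j]) =
    \sum_(i < L) \sum_j c j *: mu (S j `&` carc L i).
  rewrite exchange_big/=; apply: eq_bigr => j _.
  by rewrite (arc_partition L0 amu (mS j)) scaler_sumr.
have -> : riemann mu phi L = \sum_(i < L) \sum_j phi (zeta R L i) *: mu (S j `&` carc L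
  i).
  apply: eq_bigr => i _; rewrite (fin_additive_partition amu (mA i) mS dc cc) scaler_sumr.
  by apply: eq_bigr => j _; rewrite setIC.
rewrite -sumrB (le_trans (ler_rnorm_sum _ _ _))//.
apply: (@le_trans _ _ (\sum_(i < L) M * ((d + w) * haarR (carc (R:=R) L i)))); last first.
  rewrite -!mulr_sumr; have := arc_partition L0 (@fin_additive_haarR R) measurableT.
  by under eq_bigr do rewrite setTI; move=> <-; rewrite haarRT mulr1.
apply: ler_sum => i _; rewrite -sumrB (le_trans (ler_rnorm_sum _ _ _))//.
rewrite (fin_additive_partition (@fin_additive_haarR R) (mA i) mS dc cc) !mulr_sumr.
apply: ler_sum => j _; rewrite -scalerBl rnormZ setIC.
have mSA : measurable (carc L i `&` S j) by exact: measurableI.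
have [->|/set0P[z [iz jz]]] := eqVneq (carc L i `&` S j) set0.
  by rewrite haarR0 amu.1 rnorm0 !mulr0.
rewrite mulrCA ler_pM ?rnorm_ge0 ?bmu//.
rewrite -jz -(subrKA (phi z)) (le_trans (ler_rnormD _ _))// lerD ?sd//.
exact: pw.
Qed.

(** Supplies simple functions converging uniformly to a character; without such a sequence
    [is_integral] would hold vacuously of every v. *)
Lemma simple_arc (phi : circle R -> R[i]^o) L : (0 < L)%N ->
  exists2 s : circle R -> R[i]^o, simple_fun s &
    forall z, exists2 i : 'I_L, carc L i z & s z = phi (zeta R L i).
Proof.
move=> L0; pose idx (z : circle R) := sval (cid (arc_cover L0 z)).
have idxP z : carc L (idx z) z by exact: svalP (cid (arc_cover L0 z)).
have idxE (i : 'I_L) z : carc L i z -> idx z = i.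
  move=> iz; apply/eqP; apply: contraPT iz => ij zi.
  by have : (carc L (idx z) `&` carc L i) z by []; rewrite arc_disjoint.
exists (fun z => phi (zeta R L (idx z))); last by move=> z; exists (idx z).
split.
  apply: (@sub_finite_set _ _ ((fun i : 'I_L => phi (zeta R L i)) @` setT)).
    by move=> _ [z _ <-]; exists (idx z).
  exact: finite_image.
move=> c; rewrite (_ : _ @^-1` _ =
    \bigcup_(i in [set i : 'I_L | phi (zeta R L i) = c]) carc L i).
  by apply: fin_bigcup_measurable => // i _; exact: measurable_arc.
apply/seteqP; split => z /=; first by exists (idx z).
by move=> [i /= ic /idxE ->].
Qed.

Lemma uniform_rnormP (s : nat -> circle R -> R[i]^o) (phi : circle R -> R[i]^o) :
  {uniform, s @ \oo --> phi} <->
  forall e : R, 0 < e -> exists N, forall n, (N <= n)%N ->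
    forall z, rnorm (s n z - phi z) <= e.
Proof.
split.
  move=> h e e0.
  have : nbhs (phi : {uniform circle R -> R[i]^o})
      [set f : circle R -> R[i]^o | forall z, rnorm (phi z - f z) < e].
    apply/uniform_nbhs; exists [set p : R[i]^o * R[i]^o | rnorm (p.1 - p.2) < e].
    split; last by move=> f /= hf z; exact: hf.
    rewrite -entourage_ballE; exists e%:C; first by rewrite /= ltcR.
    by move=> p; rewrite -ball_normE /ball_ /= rnorm_lt.
  move=> /h [N _ hN]; exists N => n Nn z; rewrite rnormB_sym ltW//.
  exact: hN.
move=> h P /uniform_nbhs[U [entU UP]].
move: entU; rewrite -entourage_ballE => -[_ /complex_gt0_real[e e0 ->] eU].
have [N hN] := h _ (divr_gt0 e0 (ltr0n R 2)).
exists N => // n /= Nn; apply: UP => z _; apply: eU.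
rewrite -ball_normE /ball_ /= rnorm_lt rnormB_sym (le_lt_trans (hN _ Nn z))//.
by rewrite ltr_pdivrMr// ltr_pMr// ltr1n.
Qed.

Lemma phi_arc k e : 0 < e -> exists2 N : nat, (0 < N)%N &
  forall L, (N <= L)%N -> forall (i : 'I_L) z, carc L i z ->
    rnorm (phi_ k z - phi_ k (zeta R L i)) <= e.
Proof.
move=> e0; have [N N0 hN] := mesh_lt (`|k|%N%:R) e0.
exists N => // L NL i z iz; have L0 : (0 < L)%N by exact: leq_trans NL.
rewrite (le_trans (phi_lipschitz _ _ _))// (le_trans _ (hN _ NL))//.
by rewrite ler_wpM2l// arc_diam.
Qed.

(** Integrals of simple functions uniformly close to z^k all lie near one Riemann sum. So they are
    Cauchy along one sequence, every other sequence has the same limit, and that limit is near the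
    Riemann sum. *)
Lemma fourier_riemann mu M k : rcomplete E -> bounded_measure mu M ->
  forall e : R, 0 < e -> exists2 N : nat, (0 < N)%N &
  forall L, (N <= L)%N -> rnorm (fourier mu k - riemann mu (@phi_ R k) L) <= e.
Proof.
move=> cE bmu e e0; have M0 : 0 <= M by case: bmu.
have M10 : 0 < M + 1 by rewrite ltr_wpDl.
have MM (a : R) : 0 <= a -> M * (a / (M + 1)) <= a.
  by move=> a0; rewrite mulrCA ler_piMr// ler_pdivrMr// mul1r lerDl.
have RS (d : R) : 0 < d -> exists2 N : nat, (0 < N)%N &
    forall L, (N <= L)%N -> forall s c, simple_fun s ->
    (forall z, rnorm (s z - phi_ k z) <= c) ->
    rnorm (simple_integral mu s - riemann mu (@phi_ R k) L) <= M * c + d.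
  move=> d0; have [N N0 hN] := phi_arc k (divr_gt0 d0 M10).
  exists N => // L NL s c ss sc.
  have := simple_riemann bmu (leq_trans N0 NL) ss sc (hN _ NL).
  by move=> /le_trans; apply; rewrite mulrDr lerD2l MM// ltW.
pose s L := if pselect (0 < L)%N is left L0 then sval (cid2 (simple_arc (@phi_ R k)
  L0)) else cst 0.
have ss L : simple_fun (s L).
  rewrite /s; case: pselect => [L0|_]; first by case: cid2.
  split; first by apply: (@sub_finite_set _ _ [set 0]) => // _ [z _ <-].
  move=> c; have [->|c0] := eqVneq c 0.
    by rewrite (_ : _ @^-1` _ = setT)//; apply/seteqP; split.
  rewrite (_ : _ @^-1` _ = set0)// -subset0 => z /= h.
  by rewrite h eqxx in c0.
have su : {uniform, s @ \oo --> @phi_ R k}.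
  apply/uniform_rnormP => d d0; have [N N0 hN] := phi_arc k d0.
  exists N => L NL z; have L0 := leq_trans N0 NL.
  rewrite /s; case: pselect => // L0'; case: cid2 => f /= sf /(_ z)[i iz ->].
  by rewrite rnormB_sym hN.
have su' := (uniform_rnormP _ _).1 su.
have e30 : 0 < e / 3 by rewrite divr_gt0.
have cau : rcauchy (fun L => simple_integral mu (s L)).
  move=> d d0; have d40 : 0 < d / 4 by rewrite divr_gt0.
  have [N1 h1] := su' _ (divr_gt0 d40 M10).
  have [N2 N20 h2] := RS _ d40.
  exists N1 => n m nN mN; rewrite -(subrKA (riemann mu (@phi_ R k) N2)).
  rewrite (le_trans (ler_rnormD _ _))//.
  have := h2 _ (leqnn _) _ _ (ss n) (h1 _ nN).
  have := h2 _ (leqnn _) _ _ (ss m) (h1 _ mN).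
  rewrite (rnormB_sym (riemann _ _ _)); have := MM _ (ltW d40); lra.
have [v sv] := cE _ cau.
have iv : is_integral mu (@phi_ R k) v.
  move=> t st tu; have tu' := (uniform_rnormP _ _).1 tu.
  apply/cvg_rnormP => d d0; have d80 : 0 < d / 8 by rewrite divr_gt0.
  have [N1 h1] := su' _ (divr_gt0 d80 M10).
  have [N2 h2] := tu' _ (divr_gt0 d80 M10).
  have [N3 N30 h3] := RS _ d80.
  have [N4 _ h4] := (cvg_rnormP _ _).1 sv _ d80.
  exists N2 => // n /= N2n.
  have := h3 _ (leqnn _) _ _ (st n) (h2 _ N2n).
  have := h3 _ (leqnn _) _ _ (ss (maxn N1 N4)) (h1 _ (leq_maxl _ _)).
  have := h4 _ (leq_maxr N1 N4); have := MM _ (ltW d80) => /=.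
  set a := simple_integral mu (s _); set b := simple_integral mu (t n).
  set r := riemann _ _ _ => q1 q2 q3 q4.
  have := ler_rnormD (v - a) (a - b); have := ler_rnormD (a - r) (r - b).
  by rewrite !subrKA (rnormB_sym r) => t1 t2; lra.
(* [get] returns some value satisfying [is_integral]; testing it on the sequence s locates it. *)
have /(_ s ss su) fv : is_integral mu (@phi_ R k) (fourier mu k).
  by rewrite /fourier /vintegral; apply: getPex; exists v.
have [N1 h1] := su' _ (divr_gt0 e30 M10).
have [N2 N20 h2] := RS _ e30.
have [N3 _ h3] := (cvg_rnormP _ _).1 fv _ e30.
exists N2 => // L N2L.
have := h2 _ N2L _ _ (ss (maxn N1 N3)) (h1 _ (leq_maxl _ _)).
have := h3 _ (leq_maxr N1 N3); have := MM _ (ltW e30) => /=.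
set a := simple_integral mu (s _) => q1 q2 q3.
rewrite -(subrKA a) (le_trans (ler_rnormD _ _))//; lra.
Qed.

End BoundedMeasure.

(** * The measure of a bounded Toeplitz matrix *)

Section Construction.
Context (R : realType) (H : normedModType R[i]) (cH : rcomplete H).
Context (T : int -> blop H H) (C : R).
Hypothesis bT : matrix_bound (fun k j : nat => T (j%:Z - k%:Z)) C.
Implicit Types (B D : set (circle R)).

Let C0 : 0 <= C. Proof. by case: bT. Qed.

(** Closeness to every approximation, instead of being the limit of a chosen sequence, frees v of
    choices. The bound is that of [tapprox_Phi_dist] with the second error tending to 0. *)
Definition represents B (v : blop H H) := forall (e : R) f D, tapprox B e f D ->
  rnorm (v - Phi T f) <= C * (3 * e).

(** Off both exceptional sets f - f' is at most e + e'; on their union, of measure at most e + e',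
    it is at most 2. Hence the factor 3 = 1 + 2. *)
Lemma tapprox_Phi_dist B e e' f f' D D' : tapprox B e f D -> tapprox B e' f' D' ->
  rnorm (Phi T f - Phi T f') <= C * (3 * (e + e')).
Proof.
move=> a a'; have [mD hD _ fD] := a; have [mD' hD' _ fD'] := a'.
have e0 : 0 <= e by rewrite (le_trans (haarR_ge0 _) hD).
have e0' : 0 <= e' by rewrite (le_trans (haarR_ge0 _) hD').
have -> : Phi T f - Phi T f' = Phi T (f ++ tscale (-1) f').
  by rewrite Phi_cat Phi_scale scaleN1r.
have tz z : tev (f ++ tscale (-1) f') z = tev f z - tev f' z.
  by rewrite tev_cat tev_scale mulN1r.
have := @Phi_bound R H T C bT (f ++ tscale (-1) f') (D `|` D') (e + e') 2.
move=> /(_ (measurableU _ _ mD mD') (addr_ge0 e0 e0') (ler0n R 2)) h.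
apply: le_trans (h _ _) _ => [z|z /not_orP[Dz Dz']|].
- rewrite tz (le_trans (ler_rnormB _ _))//.
  by have := tapprox_le1 z a; have := tapprox_le1 z a'; lra.
- rewrite tz -(subrKA (ind B z)) (le_trans (ler_rnormD _ _))// lerD ?fD//.
  by rewrite rnormB_sym fD'.
- rewrite ler_wpM2l//; have := le_haarRU mD mD'; lra.
Qed.

Lemma represents_ex B : measurable B -> exists v, represents B v.
Proof.
move=> /measurable_good gB.
have en n : 0 < n.+1%:R^-1 :> R by rewrite invr_gt0.
pose f n := sval (cid (gB _ (en n))).
have fP n : exists D, tapprox B n.+1%:R^-1 (f n) D by exact: svalP (cid (gB _ (en n))).
have small (d : R) : 0 < d -> exists N, forall n, (N <= n)%N -> C * (3 * n.+1%:R^-1) <= d.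
  move=> d0; have C30 : 0 < C * 3 + 1 by rewrite ltr_wpDl// mulr_ge0.
  have [N _ hN] := near_infty_natSinv_lt (PosNum (divr_gt0 d0 C30)).
  exists N => n Nn; have /= := hN _ Nn; rewrite ltr_pdivlMr// mulrDr mulr1 => h.
  by rewrite mulrA [leLHS]mulrC (le_trans _ (ltW h))// lerDl ltW.
have [|v fv] := blop_rcomplete cH (u := fun n => Phi T (f n)).
  move=> d d0; have [N hN] := small _ (divr_gt0 d0 (ltr0n R 2)).
  exists N => n m Nn Nm; have [D a] := fP n; have [D' a'] := fP m.
  rewrite (le_trans (tapprox_Phi_dist a a'))//.
  by rewrite !mulrDr (splitr d) lerD// hN.
exists v => e g D ag.
apply/ler_addgt0Pr => d d0; have [N hN] := small _ d0.
apply: (@rnorm_cvg_le _ _ (fun n => Phi T (f n) - Phi T g)).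
  by apply: cvgB; [exact: fv|exact: cvg_cst].
exists N => // n /= Nn; have [D' a'] := fP n.
by rewrite (le_trans (tapprox_Phi_dist a' ag))// !mulrDr addrC lerD2l hN.
Qed.

Definition repr_measure B : blop H H := xget 0 [set v | represents B v].

Lemma repr_measureP B : measurable B -> represents B (repr_measure B).
Proof.
by move=> /represents_ex[v hv]; rewrite /repr_measure; apply: (xgetPex 0 (ex_intro _ v
  hv)).
Qed.

(** f is at most 1 on the union of B and D and at most e elsewhere; one e comes from there, the
    other from the measure of D. *)
Lemma tapprox_Phi_le B e f D : measurable B -> tapprox B e f D ->
  rnorm (Phi T f) <= C * (haarR B + 2 * e).
Proof.
move=> mB a; have [mD hD _ fD] := a.
have e0 : 0 <= e by rewrite (le_trans (haarR_ge0 _) hD).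
apply: (@le_trans _ _ (C * (e + 1 * haarR (B `|` D)))); last first.
  by rewrite ler_wpM2l//; have := le_haarRU mB mD; lra.
apply: (Phi_bound bT) => //; [exact: measurableU|move=> z; exact: tapprox_le1 a|].
move=> z /not_orP[Bz Dz]; have := fD _ Dz.
by rewrite /ind (_ : z \in B = false) ?subr0//; apply/negbTE; rewrite notin_setE.
Qed.

Lemma ler_addMgt0 (x y K : R) : (forall e, 0 < e -> x <= y + K * e) -> x <= y.
Proof.
move=> h; apply/ler_addgt0Pr => d d0.
have K1 : 0 < `|K| + 1 by rewrite ltr_wpDl.
rewrite (le_trans (h _ (divr_gt0 d0 K1)))// lerD2l.
rewrite mulrCA ler_piMr ?(ltW d0)// ler_pdivrMr// mul1r.
by rewrite (le_trans (ler_norm K))// lerDl.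
Qed.

Lemma repr_measure_bound B : measurable B -> rnorm (repr_measure B) <= C * haarR B.
Proof.
move=> mB; apply: (@ler_addMgt0 _ _ (C * 5)) => e e0.
have [f [D a]] := measurable_good mB e0.
have h1 := repr_measureP mB a; have h2 := tapprox_Phi_le mB a.
rewrite (le_trans (ler_rnorm_dist _ (Phi T f)))// (le_trans (lerD h2 h1))//.
by rewrite le_eqVlt; apply/orP; left; apply/eqP; ring.
Qed.

Lemma repr_measure_fin_additive : fin_additive repr_measure.
Proof.
split.
  apply: rnorm0_eq0; apply/eqP; rewrite eq_le rnorm_ge0 andbT.
  by rewrite (le_trans (repr_measure_bound measurable0))// haarR0 mulr0.
move=> A B mA mB AB; apply/eqP; rewrite -subr_eq0; apply/eqP; apply: rnorm0_eq0.
(* 21 = 3 + 12 + 6: the error on the union, the comparison of f with g + h, and the errors on A and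
   B. *)
apply/eqP; rewrite eq_le rnorm_ge0 andbT; apply: (@ler_addMgt0 _ _ (C * 21)) => e e0.
have mU : measurable (A `|` B) by exact: measurableU.
have [f [D a]] := measurable_good mU e0; have [mD hD _ fD] := a.
have [g [E b]] := measurable_good mA e0; have [mE hE _ gE] := b.
have [h [F c]] := measurable_good mB e0; have [mF hF _ hF'] := c.
have h1 := repr_measureP mU a; have h2 := repr_measureP mA b.
have h3 := repr_measureP mB c.
have mDEF : measurable (D `|` (E `|` F)) by apply: measurableU => //; exact: measurableU.
pose k := f ++ tscale (-1) (g ++ h).
have kz z : tev k z = tev f z - (tev g z + tev h z).
  by rewrite /k tev_cat tev_scale tev_cat mulN1r.
(* f - (g + h) is at most 3 everywhere and at most 3 e off a set of measure at most 3 e. *)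
have h4 : rnorm (Phi T f - (Phi T g + Phi T h)) <= C * (3 * e + 3 * (3 * e)).
  have -> : Phi T f - (Phi T g + Phi T h) = Phi T k.
    by rewrite Phi_cat Phi_scale Phi_cat scaleN1r.
  apply: (@le_trans _ _ (C * (3 * e + 3 * haarR (D `|` (E `|` F))))); last first.
    rewrite ler_wpM2l// lerD2l ler_wpM2l//.
    rewrite (le_trans (le_haarRU mD (measurableU _ _ mE mF)))//.
    by have := le_haarRU mE mF; lra.
  apply: (Phi_bound bT) => //; first by rewrite mulr_ge0// ltW.
    move=> z; rewrite kz (le_trans (ler_rnormB _ _))//.
    have := ler_rnormD (tev g z) (tev h z); have := tapprox_le1 z a.
    by have := tapprox_le1 z b; have := tapprox_le1 z c; lra.
  move=> z /not_orP[Dz /not_orP[Ez Fz]]; rewrite kz.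
  have iAB : ind (A `|` B) z = ind A z + ind B z.
    rewrite /ind in_setU; case: (boolP (z \in A)) => [Az|_]; last by rewrite add0r.
    case: (boolP (z \in B)) => [Bz|_]; last by rewrite addr0.
    by have : (A `&` B) z; [split; exact: set_mem|rewrite AB].
  have -> : tev f z - (tev g z + tev h z) =
     (tev f z - ind (A `|` B) z) - ((tev g z - ind A z) + (tev h z - ind B z)).
    by rewrite iAB; ring.
  rewrite (le_trans (ler_rnormB _ _))//.
  have := ler_rnormD (tev g z - ind A z) (tev h z - ind B z).
  by have := fD _ Dz; have := gE _ Ez; have := hF' _ Fz; lra.
set u := repr_measure (A `|` B) in h1 *; set v := repr_measure A in h2 *.
set w := repr_measure B in h3 *.
have h5 : rnorm (v + w - (Phi T g + Phi T h)) <= C * (3 * e) + C * (3 * e).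
  by rewrite opprD addrACA (le_trans (ler_rnormD _ _))// lerD.
have := ler_rnormD (u - Phi T f) (Phi T f - (v + w)).
have := ler_rnormB (Phi T f - (Phi T g + Phi T h)) (v + w - (Phi T g + Phi T h)).
rewrite opprB [_ - _ + (_ - (v + w))]subrKA subrKA add0r => t1 t2.
rewrite (le_trans t2)// (le_trans (lerD h1 t1))//.
rewrite (le_trans (lerD (lexx _) (lerD h4 h5)))//.
by rewrite le_eqVlt; apply/orP; left; apply/eqP; ring.
Qed.

Lemma bounded_repr_measure : bounded_measure repr_measure C.
Proof.
by split; [exact: repr_measure_fin_additive|exact: C0|exact: repr_measure_bound].
Qed.

(** The Riemann sum is close to [Phi T] of the polynomial sum_i zeta_i^k f_i, where f_i approximates
    the indicator of the i-th arc. Off a small set this polynomial is close to z^k, which [Phi T]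
    sends to T k. L is fixed before d tends to 0, since the errors of L arcs accumulate. *)
Lemma fourier_repr_measure k : fourier repr_measure k = T k.
Proof.
apply/eqP; rewrite -subr_eq0; apply/eqP; apply: rnorm0_eq0; apply/eqP.
rewrite eq_le rnorm_ge0 andbT; apply: (@ler_addMgt0 _ _ (1 + C)) => w w0.
rewrite add0r.
have [N1 N10 h1] := fourier_riemann k (blop_rcomplete cH) bounded_repr_measure w0.
have [N2 N20 h2] := phi_arc k w0.
pose L := maxn N1 N2; have L0 : (0 < L)%N by rewrite leq_max N10.
have {}h1 := h1 L (leq_maxl _ _); have {}h2 := h2 L (leq_maxr _ _).
suff h3 : rnorm (riemann repr_measure (@phi_ R k) L - T k) <= C * w.
  have := ler_rnormD (fourier repr_measure k - riemann repr_measure (@phi_ R k) L)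
    (riemann repr_measure (@phi_ R k) L - T k).
  by rewrite subrKA => /le_trans; apply; rewrite mulrDl mul1r lerD.
have mA (i : 'I_L) : measurable (carc (R:=R) L i) by exact: measurable_arc.
(* 3 L from the values of the measure on the arcs, L from the polynomials off E, and L (L + 1) from
   E itself. *)
apply: (@ler_addMgt0 _ _ (C * L%:R * (5 + L%:R))) => d d0.
have ap (i : 'I_L) : exists fD, tapprox (carc L i) d fD.1 fD.2.
  by have [f [D a]] := measurable_good (mA i) d0; exists (f, D).
pose f i := (sval (cid (ap i))).1; pose D i := (sval (cid (ap i))).2.
have fP (i : 'I_L) : tapprox (carc L i) d (f i) (D i) by exact: svalP (cid (ap i)).
have mD i : measurable (D i) by case: (fP i).
pose z_ (i : 'I_L) := phi_ k (zeta R L i).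
pose g := flatten [seq tscale (z_ i) (f i) | i <- enum 'I_L] ++ tscale (-1) [:: (1, k)].
have tg z : tev g z = \sum_(i < L) z_ i * tev (f i) z - phi_ k z.
  rewrite /g tev_cat tev_scale tev1 mul1r mulN1r; congr (_ - _).
  rewrite /tev big_flatten big_map big_enum/=; apply: eq_bigr => i _.
  by rewrite -/(tev _ _) tev_scale.
have Pg : Phi T g = \sum_(i < L) z_ i *: Phi T (f i) - T k.
  rewrite /g Phi_cat Phi_scale Phi1 scale1r scaleN1r; congr (_ - _).
  rewrite /Phi big_flatten big_map big_enum/=; apply: eq_bigr => i _.
  by rewrite -/(Phi _ _) Phi_scale.
pose E := \big[setU/set0]_(i <- index_enum 'I_L) D i.
have [mE hE] := @le_haarR_bigU R _ (index_enum 'I_L) D mD.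
have {}hE : haarR E <= L%:R * d.
  rewrite (le_trans hE)// (le_trans (ler_sum _ (_ : forall i, true -> haarR (D i) <=
    d)))//.
    by move=> i _; case: (fP i).
  by rewrite sumr_const card_ord mulr_natl.
have gb : rnorm (Phi T g) <= C * ((L%:R * d + w) + (L%:R + 1) * haarR E).
  apply: (Phi_bound bT) => //.
  - by rewrite addr_ge0// ?mulr_ge0// ltW.
  - move=> z; rewrite tg (le_trans (ler_rnormB _ _))// rnorm_phi lerD2r.
    rewrite (le_trans (ler_rnorm_sum _ _ _))//.
    rewrite (le_trans (ler_sum _ (_ : forall i, true -> _ <= 1)))//.
      by move=> i _; rewrite rnormM rnorm_phi mul1r (tapprox_le1 _ (fP i)).
    by rewrite sumr_const card_ord.
  - move=> z Ez; have Dz i : ~ D i z.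
      by move=> Di; apply: Ez; rewrite /E -bigcup_seq; exists i => //=; rewrite
        mem_index_enum.
    rewrite tg.
    have [i0 iz] := arc_cover L0 z.
    have zE : \sum_(i < L) z_ i * ind (carc L i) z = z_ i0.
      rewrite (bigD1 i0)//= big1 ?addr0 => [|i ii0].
        by rewrite /ind mem_set// mulr1.
      rewrite /ind (_ : z \in carc L i = false) ?mulr0//.
      apply/negbTE; rewrite notin_setE => iz'.
      by have : (carc L i `&` carc L i0) z by []; rewrite arc_disjoint.
    rewrite -(subrKA (z_ i0)) -{1}zE -sumrB (le_trans (ler_rnormD _ _))// lerD//.
      rewrite (le_trans (ler_rnorm_sum _ _ _))//.
      rewrite (le_trans (ler_sum _ (_ : forall i, true -> _ <= d)))//.
        move=> i _; rewrite -mulrBr rnormM rnorm_phi mul1r.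
        by case: (fP i) => _ _ _; apply.
      by rewrite sumr_const card_ord mulr_natl.
    by rewrite rnormB_sym h2.
have rb : rnorm (riemann repr_measure (@phi_ R k) L - \sum_(i < L) z_ i *: Phi T (f i))
    <= L%:R * (C * (3 * d)).
  rewrite -sumrB (le_trans (ler_rnorm_sum _ _ _))//.
  rewrite (le_trans (ler_sum _ (_ : forall i, true -> _ <= C * (3 * d))))//.
    move=> i _; rewrite -scalerBr rnormZ rnorm_phi mul1r.
    exact: repr_measureP (mA i) _ _ _ (fP i).
  by rewrite sumr_const card_ord -[leLHS]mulr_natl.
have := ler_rnormD (riemann repr_measure (@phi_ R k) L - \sum_(i < L) z_ i *: Phi T (f
  i)) (Phi T g).
rewrite {1}Pg subrKA => /le_trans; apply.
rewrite (le_trans (lerD rb gb))//.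
have : C * ((L%:R + 1) * haarR E) <= C * ((L%:R + 1) * (L%:R * d)).
  by rewrite ler_wpM2l// ler_wpM2l// addr_ge0.
rewrite mulrDr => h; rewrite (le_trans (lerD (lexx _) (lerD (lexx _) h)))//.
by rewrite le_eqVlt; apply/orP; left; apply/eqP; ring.
Qed.

End Construction.

(** * Countable additivity and regularity of measures dominated by Haar measure *)

Section Vmeasure.
Context (R : realType) (E : normedModType R[i]).
Implicit Types (mu : set (circle R) -> E) (B : set (circle R)).

(** The remainder of the series is the value on the tail [G n], whose Haar measure tends to 0. *)
Lemma bounded_countably_additive mu M : bounded_measure mu M -> countably_additive mu.
Proof.
move=> [[mu0 amu] M0 bmu] F mF tF.
have mU n : measurable (\big[setU/set0]_(i < n) F i) by exact: bigsetU_measurable.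
have sumE n : \sum_(0 <= i < n) mu (F i) = mu (\big[setU/set0]_(i < n) F i).
  elim: n => [|n ih]; first by rewrite big_nil big_ord0 mu0.
  rewrite big_nat_recr//= ih big_ord_recr/= amu//; first exact: mU.
  rewrite -subset0 -bigcup_mkord => z [[i /= ni Fi] Fn].
  have : (F i `&` F n) z by [].
  by move/trivIsetP : tF => /(_ i n I I (negbT (ltn_eqF ni))) ->.
pose G n := \bigcup_i F i `\` \big[setU/set0]_(i < n) F i.
have mUF : measurable (\bigcup_i F i) by exact: bigcup_measurable.
have mG n : measurable (G n) by exact: measurableD.
have GE n : mu (\bigcup_i F i) - \sum_(0 <= i < n) mu (F i) = mu (G n).
  rewrite sumE; apply/eqP; rewrite subr_eq addrC -amu//; last exact: setDIK.
  apply/eqP; congr mu; rewrite setDUK// => z.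
  by rewrite -bigcup_mkord => -[i _ Fi]; exists i.
apply/cvg_rnormP => e e0.
have M1 : 0 < M + 1 by rewrite ltr_wpDl.
have niG : nonincreasing_seq G.
  move=> n m nm; apply/subsetPset => z [Uz Gz]; split => // h; apply: Gz.
  move: h; rewrite -!bigcup_mkord => -[i /= ni Fi].
  by exists i => //=; exact: leq_trans nm.
have [N hN] : exists N, haarR (G N) <= e / (M + 1).
  apply: haarR_cvg0 => //; last by rewrite divr_gt0.
  rewrite -subset0 => z h; have [[i _ Fi] _] := h 0%N I.
  by have [_] := h i.+1 I; apply; rewrite -bigcup_mkord; exists i => /=.
exists N => // n /= Nn; rewrite GE (le_lt_trans (bmu _ (mG n)))//.
have hn : haarR (G n) <= e / (M + 1).
  by rewrite (le_trans _ hN)// le_haarR//; exact/subsetPset/niG.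
rewrite (le_lt_trans (ler_wpM2l M0 hn))// mulrA ltr_pdivrMr// mulrC ltr_pM2l//.
by rewrite ltrDl.
Qed.

(** Inner regularity of Lebesgue measure on [0, 2 pi), carried over by [expi], which maps compact
    sets to compact sets. *)
Lemma haar_inner (B : set (circle R)) (e : R) : 0 < e -> measurable B ->
  exists K : set (circle R), [/\ compact K, K `<=` B & haarR (B `\` K) < e].
Proof.
move=> e0 mB.
have p0 : 0 < 2 * pi :> R by rewrite mulr_gt0// pi_gt0.
pose D := `[0%R, (2 * pi)%R[ `&` @expi R @^-1` B.
have mD : measurable D.
  apply: measurableI; first exact: measurable_itv.
  by rewrite -[X in measurable X]setTI; exact: measurable_expi.
have Dfin : (lebesgue_measure D < +oo)%E.
  apply: (@le_lt_trans _ _ (lebesgue_measure (`[0%R, (2 * pi)%R[%classic : set R))).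
    by apply: le_measure; rewrite ?inE; [exact: mD|exact: measurable_itv|exact: subIsetl].
  by rewrite lebesgue_measure_itv/= lte_fin p0 ltry.
have [V [cV VD hV]] := lebesgue_regularity_inner mD Dfin (mulr_gt0 p0 e0).
have cK : compact (@expi R @` V).
  by apply: continuous_compact => //; apply: continuous_subspaceT => t; exact:
    continuous_expi.
have mK := measurable_compact_circle cK.
exists (@expi R @` V); split => //.
  by move=> _ [t /VD[_ Bt] <-].
rewrite -lte_fin -haarE; last exact: measurableD.
rewrite /haar lte_pdivrMl// -EFinM.
apply: le_lt_trans hV; apply: le_measure; rewrite ?inE.
- apply: measurableI; first exact: measurable_itv.
  by rewrite -[X in measurable X]setTI; apply: measurable_expi => //; exact: measurableD.
- by apply: measurableD => //; exact: measurable_realfun.compact_measurable.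
- move=> t [t0 [/= Bt nt]]; split; first by split.
  by move=> Vt; apply: nt; exists t.
Qed.

(** The open set is the complement of a compact set filling the complement of B from inside. The
    semivariation is at most M times Haar measure, since each sum over a finite partition is. *)
Lemma bounded_regular mu M : bounded_measure mu M -> regular_measure mu.
Proof.
move=> [[mu0 amu] M0 bmu] e B e0 mB.
have M1 : 0 < M + 1 by rewrite ltr_wpDl.
have d0 : 0 < e / (M + 1) / 2 by rewrite !divr_gt0.
have [K [cK KB hK]] := haar_inner d0 mB.
have [K' [cK' KB' hK']] := haar_inner d0 (measurableC mB).
have mK := measurable_compact_circle cK; have mK' := measurable_compact_circle cK'.
exists K, (~` K'); split => //.
- by apply: closed_openC; exact: compact_closed (@hausdorff_circle R) cK'.
- by move=> z Bz /KB'.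
have mOK : measurable (~` K' `\` K) by apply: measurableD => //; exact: measurableC.
have hOK : haarR (~` K' `\` K) < e / (M + 1).
  rewrite (_ : _ `\` _ = (B `\` K) `|` (~` B `\` K')); last first.
    apply/seteqP; split => z.
      by move=> [nK' nK]; have [Bz|Bz] := pselect (B z); [left|right].
    by move=> [[Bz nK]|[Bz nK']]; split => //; [move=> /KB'|move=> /KB].
  rewrite (le_lt_trans (le_haarRU _ _))//; try exact: measurableD.
    by apply: measurableD => //; exact: measurableC.
  by rewrite (splitr (e / (M + 1))) ltrD.
apply: (@le_lt_trans _ _ (M * haarR (~` K' `\` K))%:E); last first.
  rewrite lte_fin (le_lt_trans (ler_wpM2l M0 (ltW hOK)))//.
  by rewrite mulrA ltr_pdivrMr// mulrC ltr_pM2l// ltrDl.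
apply: ge_ereal_sup => _ [f /= f1 <-]; apply: ge_ereal_sup => _ [n [F [mF tF UF ->]]].
rewrite lee_fin.
have f1' : rnorm f = 1 by rewrite /rnorm f1.
have hF : \sum_(i < n) haarR (F i) = haarR (~` K' `\` K).
  have dF (i j : 'I_n) : i != j -> F i `&` F j = set0.
    by move/trivIsetP : tF => /(_ i j I I); exact.
  have [_ <-] := fin_additive_bigU (@fin_additive_haarR R) mF dF (index_enum_uniq 'I_n).
  congr haarR; rewrite -UF -bigcup_seq; apply/seteqP; split => z [i _ Fi]; exists i =>
    //=.
  by rewrite mem_index_enum.
rewrite -hF mulr_sumr; apply: ler_sum => i _.
by rewrite (le_trans (rnorm_blop_le _ _))// f1' mul1r bmu.
Qed.

Lemma bounded_Vinfty mu M : bounded_measure mu M -> Vinfty mu.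
Proof.
move=> bmu; split; first by split; [exact: bounded_countably_additive bmu|exact:
  bounded_regular bmu].
have [_ M0 b] := bmu.
(* [Vinfty] asks for a positive constant, and M may be 0. *)
exists (M + 1); first by rewrite ltr_wpDl.
move=> A mA; rewrite haarE// -EFinM lee_fin (le_trans (b _ mA))//.
by rewrite ler_wpM2r ?haarR_ge0// lerDl.
Qed.

End Vmeasure.

(** * Bounds for the Toeplitz matrix of a measure *)

Section Lower.
Context (R : realType) (E : normedModType R[i]) (cE : rcomplete E).
Context (mu : set (circle R) -> E) (M : R).
Hypothesis bmu : bounded_measure mu M.

Lemma fourier_riemann_seq (s : seq int) (e : R) : 0 < e ->
  exists2 N : nat, (0 < N)%N & forall L, (N <= L)%N -> forall k, k \in s ->
    rnorm (fourier mu k - riemann mu (@phi_ R k) L) <= e.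
Proof.
move=> e0; elim: s => [|k s [N N0 hN]]; first by exists 1%N.
have [N' N'0 hN'] := fourier_riemann k cE bmu e0.
exists (maxn N N'); first by rewrite leq_max N0.
move=> L; rewrite geq_max => /andP[NL N'L] l.
by rewrite in_cons => /predU1P[->|]; [exact: hN'|exact: hN].
Qed.

(** [Phi (fourier mu)] acts as integration against mu on trigonometric polynomials; linearity of
    Riemann sums carries the estimate from characters to f. *)
Lemma Phi_riemann f (e : R) : 0 < e -> exists2 N : nat, (0 < N)%N &
  forall L, (N <= L)%N ->
    rnorm (Phi (fourier mu) f - riemann mu (tev f) L) <= e.
Proof.
move=> e0; set S := \sum_(p <- f) rnorm (p.1 : R[i]^o).
have S0 : 0 <= S by rewrite sumr_ge0// => p _; exact: rnorm_ge0.
have S1 : 0 < S + 1 by rewrite ltr_wpDl.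
have [N N0 hN] := fourier_riemann_seq [seq p.2 | p <- f] (divr_gt0 e0 S1).
exists N => // L /hN {}hN.
have -> : riemann mu (tev f) L = \sum_(p <- f) p.1 *: riemann mu (@phi_ R p.2) L.
  rewrite /riemann; under eq_bigr do rewrite /tev scaler_suml.
  rewrite exchange_big/=; apply: eq_bigr => p _; rewrite scaler_sumr.
  by apply: eq_bigr => i _; rewrite scalerA.
rewrite /Phi -sumrB (le_trans (ler_rnorm_sum _ _ _))//.
rewrite (@le_trans _ _ (\sum_(p <- f) rnorm (p.1 : R[i]^o) * (e / (S + 1))))//.
  rewrite big_seq [leRHS]big_seq; apply: ler_sum => p pf.
  rewrite -scalerBr rnormZ ler_wpM2l ?rnorm_ge0// hN//.
  by apply/mapP; exists p.
rewrite -mulr_suml -/S mulrCA ler_piMr ?(ltW e0)// ler_pdivrMr// mul1r lerDl//.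
Qed.

(** Each arc is cut into its parts inside and outside B, which receive the coefficients 1 - f(zeta)
    and -f(zeta). These are at most e + d on a part that leaves D and at most 1 on a part inside D,
    which adds up to e + d + m(D). *)
Lemma tapprox_measure B e f D : measurable B -> tapprox B e f D ->
  rnorm (mu B - Phi (fourier mu) f) <= M * (2 * e).
Proof.
move=> mB a; have [mD hD f01 fD] := a; have [amu M0 hmu] := bmu.
have e0 : 0 <= e by rewrite (le_trans (haarR_ge0 _) hD).
apply: (@ler_addMgt0 _ _ _ (1 + M)) => d d0.
have [N N0 hN] := Phi_riemann f d0; have [N' N'0 hN'] := mesh_lt (tlip f) d0.
pose L := maxn N N'; have L0 : (0 < L)%N by rewrite leq_max N0.
have {}hN := hN L (leq_maxl _ _); have {}hN' := hN' L (leq_maxr _ _).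
suff h : rnorm (mu B - riemann mu (tev f) L) <= M * (2 * e + d).
  have := ler_rnormD (mu B - riemann mu (tev f) L) (riemann mu (tev f) L - Phi (fourier
    mu) f).
  rewrite subrKA => /le_trans; apply; rewrite (rnormB_sym (riemann _ _ _)).
  rewrite (le_trans (lerD h hN))// mulrDr mulrDl mul1r; lra.
have mA (i : 'I_L) : measurable (carc (R:=R) L i) by exact: measurable_arc.
have part (S : set (circle R)) (i : 'I_L) (c : R[i]^o) : measurable S -> S `<=` carc L
  i ->
    rnorm c <= 1 -> (forall z, S z -> ~ D z -> rnorm c <= e + d) ->
    rnorm (c *: mu S) <= M * ((e + d) * haarR S + haarR (D `&` S)).
  move=> mS SA c1 hc; rewrite rnormZ (le_trans (ler_wpM2l (rnorm_ge0 _) (hmu _ mS)))//.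
  rewrite mulrCA ler_wpM2l//.
  have [SD|/existsNP[z /not_implyP[Sz Dz]]] := pselect (forall z, S z -> D z).
    have -> : D `&` S = S by apply/seteqP; split => [z []//|z Sz]; split => //; exact: SD.
    by rewrite ler_wpDl ?mulr_ge0 ?haarR_ge0 ?addr_ge0 ?(ltW d0)// ler_piMl ?haarR_ge0.
  by rewrite ler_wpDr ?haarR_ge0// ler_wpM2r ?haarR_ge0//; exact: hc Dz.
rewrite (arc_partition L0 amu mB) /riemann -sumrB (le_trans (ler_rnorm_sum _ _ _))//.
apply: (@le_trans _ _ (\sum_(i < L) M * ((e + d) * haarR (carc (R:=R) L i) + haarR (D
  `&` carc L i)))); last first.
  rewrite -mulr_sumr big_split/= -mulr_sumr -(arc_partition L0 (@fin_additive_haarR R)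
    mD).
  have := arc_partition L0 (@fin_additive_haarR R) measurableT.
  under eq_bigr do rewrite setTI; move=> <-; rewrite haarRT mulr1 ler_wpM2l//; lra.
apply: ler_sum => i _.
pose S1 := B `&` carc L i; pose S2 := carc (R:=R) L i `\` B.
have mS1 : measurable S1 by exact: measurableI.
have mS2 : measurable S2 by exact: measurableD.
have S12 : S1 `&` S2 = set0 by apply/seteqP; split => // z [[Bz _] [_]].
have AE : carc L i = S1 `|` S2.
  apply/seteqP; split => z; last by move=> [[]//|[]].
  by move=> Az; have [Bz|Bz] := pselect (B z); [left|right].
have /andP[f0 f1] := f01 (zeta R L i).
have fz z : carc L i z -> rnorm (tev f z - tev f (zeta R L i)) <= d.
  by move=> iz; rewrite (le_trans _ hN')// tev_arc.
rewrite -/S1 {1}AE amu.2// scalerDr opprD addrA -{1}[mu S1]scale1r -scalerBl -scaleNr.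
rewrite (le_trans (ler_rnormD _ _))//.
apply: (@le_trans _ _ (M * ((e + d) * haarR S1 + haarR (D `&` S1)) +
    M * ((e + d) * haarR S2 + haarR (D `&` S2)))).
  apply: lerD; apply: part => //.
  - exact: subIsetr.
  - by apply: rnorm01; rewrite subr_ge0 f1 lerBlDr lerDl.
  - move=> z [Bz iz] Dz; have := fD _ Dz; rewrite /ind mem_set// => h1.
    have := ler_rnormD (1 - tev f z) (tev f z - tev f (zeta R L i)).
    by rewrite subrKA => /le_trans; apply; rewrite lerD ?fz// rnormB_sym.
  - exact: subDsetl.
  - by rewrite rnormN; apply: rnorm01; rewrite f0.
  - move=> z [iz Bz] Dz; have := fD _ Dz; rewrite /ind memNset// subr0 => h1.
    rewrite rnormN (le_trans (ler_rnorm_dist _ (tev f z)))// lerD//.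
    by rewrite rnormB_sym fz.
rewrite -mulrDr ler_wpM2l//.
have -> : haarR (carc (R:=R) L i) = haarR S1 + haarR S2 by rewrite {1}AE haarRU.
have -> : haarR (D `&` carc L i) = haarR (D `&` S1) + haarR (D `&` S2).
  by rewrite {1}AE setIUr haarRU//; [exact: measurableI|exact: measurableI|rewrite
    setIACA S12 setI0].
by rewrite le_eqVlt; apply/orP; left; apply/eqP; ring.
Qed.

End Lower.

(** M enters only through errors that vanish with e, which leaves the bound C of [Phi]. This is the
    inequality of norms opposite to the one obtained from Parseval's identity. *)
Lemma bounded_measure_sharp (R : realType) (H : normedModType R[i]) (mu : set (circle
  R) -> blop H H)
    (M C : R) : rcomplete H -> bounded_measure mu M ->
  matrix_bound (fun k j : nat => fourier mu (j%:Z - k%:Z)) C ->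
  bounded_measure mu C.
Proof.
move=> cH bmu bC; have [amu M0 hmu] := bmu; have [C0 _] := bC.
split => // B mB; apply: (@ler_addMgt0 _ _ _ (2 * M + 2 * C)) => e e0.
have [f [D a]] := measurable_good mB e0.
have h1 := tapprox_measure (blop_rcomplete cH) bmu mB a.
have h2 := tapprox_Phi_le bC mB a.
rewrite (le_trans (ler_rnorm_dist _ (Phi (fourier mu) f)))// (le_trans (lerD h2 h1))//.
by rewrite le_eqVlt; apply/orP; left; apply/eqP; ring.
Qed.

Section Upper.
Context (R : realType) (H : normedModType R[i]) (dot : {dot H for Num.conj}).
Hypothesis dotP : forall x : H, `|x| ^+ 2 = dot x x.

(** Distinct frequencies with differences below L stay orthogonal on the L-th roots of unity, so the
    identity is exact. *)
Lemma parseval L n (k : 'I_n -> int) (u : 'I_n -> H) : injective k ->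
  (forall i j, `|k i - k j| < L)%N ->
  \sum_(i < L) rnorm (\sum_j phi_ (k j) (zeta R L i) *: u j) ^+ 2 =
  L%:R * \sum_j rnorm (u j) ^+ 2.
Proof.
move=> kinj kL.
have sqE (x : H) : (rnorm x ^+ 2)%:C = dot x x by rewrite -dotP rnormE rmorphXn.
apply: (can_inj (f := real_complex R) (g := @complex.Re R)) => //.
rewrite rmorphM rmorph_nat !rmorph_sum/=.
under eq_bigr do rewrite sqE linear_sumlz.
under [in RHS]eq_bigr do rewrite sqE.
rewrite exchange_big/= mulr_sumr; apply: eq_bigr => j _.
have conjE l z : Num.conj (phi_ l z : R[i]) = phi_ (- l) z.
  by rewrite !phi_exp rmorphXz ?phi_unit//= -phi_conj -exprz_inv.
under eq_bigr do rewrite linear_sumr.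
rewrite exchange_big/=.
have term j' : \sum_(i < L) dot (phi_ (k j) (zeta R L i) *: u j)
    (phi_ (k j') (zeta R L i) *: u j') =
    (if k j - k j' == 0 then L%:R else 0) * dot (u j) (u j').
  rewrite -sum_phi_zeta// mulr_suml; apply: eq_bigr => i _.
  by rewrite linearZl_LR linearZr_LR/= conjE mulrA -phiD.
rewrite (bigD1 j)//= [X in _ + X]big1 ?addr0 => [|j' jj'].
  by rewrite term subrr eqxx.
rewrite term ifF ?mul0r//; apply/negbTE; rewrite subr_eq0.
by apply: contra jj' => /eqP/kinj ->.
Qed.

Lemma bounded_measure_matrix (mu : set (circle R) -> blop H H) (M : R) :
  rcomplete H -> bounded_measure mu M ->
  matrix_bound (fun k j : nat => fourier mu (j%:Z - k%:Z)) M.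
Proof.
move=> cH bmu; have [amu M0 hmu] := bmu.
apply/matrix_boundP; split => // n m x.
set S := M ^+ 2 * _.
have S0 : 0 <= S by rewrite mulr_ge0 ?sqr_ge0// sumr_ge0// => *; exact: sqr_ge0.
pose y k := \sum_(j < n) fourier mu (j%:Z - k%:Z) (x j).
pose yL L k := \sum_(j < n) riemann mu (@phi_ R (j%:Z - k%:Z)) L (x j).
have yLS L : (n <= L)%N -> (m <= L)%N -> (0 < L)%N ->
    \sum_(k < m) rnorm (yL L k) ^+ 2 <= S.
  move=> nL mL L0; have Lr0 : 0 < L%:R :> R by rewrite ltr0n.
  pose X (i : nat) : H := \sum_(j < n) phi_ j%:Z (zeta R L i) *: x j.
  pose v (i : 'I_L) : H := mu (carc L i) (X i).
  have yLE k : yL L k = \sum_(i < L) phi_ (- k%:Z) (zeta R L i) *: v i.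
    rewrite /yL; under eq_bigr do rewrite blop_sumE.
    rewrite exchange_big/=; apply: eq_bigr => i _; rewrite /v /X blop_sumr scaler_sumr.
    by apply: eq_bigr => j _; rewrite -[LHS]/(phi_ _ _ *: (mu (carc L i) (x j))) blopZ
      scalerA -phiD addrC.
  have vX i : rnorm (v i) <= M / L%:R * rnorm (X i).
    rewrite (le_trans (rnorm_blop_le _ _))// ler_wpM2r ?rnorm_ge0//.
    by rewrite (le_trans (hmu _ (measurable_arc _ _)))// haarR_arc.
  (* Row index and root index are interchangeable in zeta_i^-k, so the outer transform also falls
     under [parseval], with frequencies -i. *)
  have phiC (k i : nat) : phi_ (- k%:Z) (zeta R L i) = phi_ (- i%:Z) (zeta R L k).
    by rewrite !phi_exp -!exprz_inv (zeta_mul R L i) (zeta_mul R L k) -!exprnP -!exprVn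
      -!exprM mulnC.
  (* Extending the m rows to L makes the sum over k run over all roots of unity. *)
  apply: (@le_trans _ _ (\sum_(k < L) rnorm (yL L k) ^+ 2)).
    rewrite (big_ord_widen L (fun k => rnorm (yL L k) ^+ 2) mL) [leRHS](bigID (fun k :
      'I_L => (k < m)%N))/=.
    by rewrite lerDl sumr_ge0// => *; exact: sqr_ge0.
  under eq_bigr do rewrite yLE.
  under eq_bigr => k _ do under eq_bigr => i _ do rewrite phiC.
  rewrite parseval; first last.
  - by move=> i j; have := ltn_ord i; have := ltn_ord j; lia.
  - by move=> i j /oppr_inj [] /val_inj.
  (* Arcs have measure 1/L: the resulting (M / L)^2 cancels the two factors L of Parseval. *)
  apply: (@le_trans _ _ (L%:R * \sum_(i < L) (M / L%:R) ^+ 2 * rnorm (X i) ^+ 2)).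
    rewrite ler_wpM2l// ler_sum// => i _; rewrite -exprMn.
    by rewrite ler_pXn2r// nnegrE ?rnorm_ge0 ?mulr_ge0 ?invr_ge0 ?rnorm_ge0.
  rewrite -mulr_sumr parseval; first last.
  - by move=> i j; have := ltn_ord i; have := ltn_ord j; lia.
  - by move=> i j [] /val_inj.
  rewrite /S le_eqVlt; apply/orP; left; apply/eqP.
  by field; rewrite gt_eqF.
(* A bound independent of L, for the cross term 2 b d that appears when a norm b is enlarged by
   d. *)
have yb L k : (n <= L)%N -> (m <= L)%N -> (0 < L)%N -> (k < m)%N -> rnorm (yL L k) <= S
  + 1.
  move=> nL mL L0 km.
  have : rnorm (yL L k) ^+ 2 <= S.
    apply: le_trans (yLS _ nL mL L0); rewrite (bigD1 (Ordinal km))//= lerDl.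
    by rewrite sumr_ge0// => *; exact: sqr_ge0.
  by have := rnorm_ge0 (yL L k); nra.
pose s := [seq (j%:Z - k%:Z)%R | j <- iota 0 n, k <- iota 0 m].
set W := \sum_(j < n) rnorm (x j).
have W0 : 0 <= W by rewrite sumr_ge0// => *; exact: rnorm_ge0.
have W1 : 0 < W + 1 by rewrite ltr_wpDl.
apply: (@ler_addMgt0 _ _ _ (m%:R * (2 * (S + 1) + 1))) => e e0.
(* The cap 1 keeps 2 b + d at most 2 (S + 1) + 1. *)
pose d := Num.min e 1.
have d0 : 0 < d by rewrite lt_min e0 ltr01.
have de : d <= e by rewrite ge_min lexx.
have d1 : d <= 1 by rewrite ge_min lexx orbT.
have [N N0 hN] := fourier_riemann_seq (blop_rcomplete cH) bmu s (divr_gt0 d0 W1).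
pose L := maxn N (maxn n m).
have L0 : (0 < L)%N by rewrite leq_max N0.
have nL : (n <= L)%N by rewrite !leq_max leqnn orbT.
have mL : (m <= L)%N by rewrite !leq_max leqnn !orbT.
have yd k : (k < m)%N -> rnorm (y k) <= rnorm (yL L k) + d.
  move=> km; rewrite (le_trans (ler_rnorm_dist _ (yL L k)))// lerD2l.
  rewrite /y /yL -sumrB (le_trans (ler_rnorm_sum _ _ _))//.
  apply: (@le_trans _ _ (\sum_(j < n) d / (W + 1) * rnorm (x j))).
    apply: ler_sum => j _; rewrite -[_ - _]/((_ - _ : blop H H) (x j)).
    rewrite (le_trans (rnorm_blop_le _ _))// ler_wpM2r ?rnorm_ge0//.
    apply: hN; first exact: leq_maxl.
    by apply/allpairsP; exists (val j, k); rewrite !mem_iota /= ltn_ord.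
  by rewrite -mulr_sumr mulrAC ler_pdivrMr// ler_wpM2l ?(ltW d0)// lerDl.
apply: (@le_trans _ _ (\sum_(k < m) (rnorm (yL L k) ^+ 2 + e * (2 * (S + 1) + 1)))).
  apply: ler_sum => k _; rewrite -/(y k).
  have := yd k (ltn_ord k); have := yb L k nL mL L0 (ltn_ord k).
  have := rnorm_ge0 (y k); have := rnorm_ge0 (yL L k).
  move: (rnorm (y k)) (rnorm (yL L k)) => a b b0 a0 bS ab.
  have h1 : a ^+ 2 <= (b + d) ^+ 2.
    by rewrite ler_pXn2r// nnegrE addr_ge0// ltW.
  have h2 : d * (2 * b + d) <= e * (2 * (S + 1) + 1).
    by apply: ler_pM; [exact: ltW|rewrite addr_ge0 ?mulr_ge0// ltW|exact: de|lra].
  by rewrite (le_trans h1)// sqrrD -addrA lerD2l; apply: le_trans h2; lra.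
rewrite big_split/= sumr_const card_ord -[leLHS]/(_ + _) lerD ?yLS//.
by rewrite -[leLHS]mulr_natl mulrCA mulrC.
Qed.

End Upper.

(** * Toeplitz symbols, the least bound of a measure, and the equivalence *)

Lemma toeplitz_symbol (R : realType) (H : normedModType R[i]) (A : nat -> nat -> blop H
  H) :
  toeplitz A -> exists T : int -> blop H H,
    A = fun k j : nat => T (j%:Z - k%:Z).
Proof.
move=> tA; exists (fun l => if l is Posz n then A 0%N n else A `|l|%N 0%N).
(* Nonnegative differences were read in the first row, negative ones in the first column. *)
apply/funext => k; apply/funext => j.
by case E : (j%:Z - k%:Z) => [n|n]; apply: tA; rewrite ?NegzE ?absz_nat in E *; lia.
Qed.

(** The supremum sees only sets of positive measure; on null sets the bound known beforehand makes
    mu vanish. The whole circle shows that the supremum is over a nonempty set and is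
    nonnegative. *)
Lemma Vinfty_norm_bounded (R : realType) (E : normedModType R[i])
    (mu : set (circle R) -> E) : Vinfty mu -> bounded_measure mu (Vinfty_norm mu) /\
  forall C, bounded_measure mu C -> Vinfty_norm mu <= C.
Proof.
move=> /Vinfty_bounded[M0 bmu]; have [amu M00 hmu] := bmu.
set V := [set rnorm (mu A) / fine (haar A) | A in [set A | measurable A /\ (0 < haar
  A)%E]].
have VM C : bounded_measure mu C -> ubound V C.
  move=> [_ _ hC] _ [A [mA A0] <-]; rewrite -/(haarR A) ler_pdivrMr ?hC//.
  by rewrite -lte_fin -haarE.
have VT : V (rnorm (mu setT) / haarR (@setT (circle R))).
  by exists setT => //; split; [exact: measurableT|rewrite haarT].
have supV : has_sup V by split; [eexists; exact: VT|exists M0; exact: VM].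
split; last by move=> C /VM VC; apply: ge_sup => //; exists (rnorm (mu setT) / haarR
  (@setT (circle R))).
split => //.
  apply: le_trans (sup_upper_bound supV VT).
  by rewrite divr_ge0 ?rnorm_ge0 ?haarR_ge0.
move=> B mB; have := haarR_ge0 B; rewrite le_eqVlt => /predU1P[B0|B0].
  by rewrite -B0 mulr0 (le_trans (hmu _ mB))// -B0 mulr0.
rewrite -ler_pdivrMr//; apply: (sup_upper_bound supV); exists B => //.
by split => //; rewrite haarE// lte_fin.
Qed.

Theorem theorem5p1 (R : realType) (H : completeNormedModType R[i])
    (dot : {dot H for Num.conj}) (dotP : hilbert_dot dot) (sepH : separable H)
    (A : nat -> nat -> blop H H) (toepA : toeplitz A) :
  (matrix_bounded A <->
     exists mu : set (circle R) -> blop H H, Vinfty mu /\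
       forall k j : nat, A k j = fourier mu (j%:Z - k%:Z)) /\
  (forall mu : set (circle R) -> blop H H, Vinfty mu ->
     (forall k j : nat, A k j = fourier mu (j%:Z - k%:Z)) ->
     matrix_norm A = Vinfty_norm mu).
Proof.
have cH : rcomplete H by exact: completeNormedMod_rcomplete.
have AE (mu : set (circle R) -> blop H H) :
    (forall k j : nat, A k j = fourier mu (j%:Z - k%:Z)) ->
    A = fun k j : nat => fourier mu (j%:Z - k%:Z).
  by move=> h; apply/funext => k; apply/funext => j.
split; first split.
- move=> [C bC]; have [T AT] := toeplitz_symbol toepA; rewrite AT in bC.
  exists (repr_measure T C); split.
    exact: bounded_Vinfty (bounded_repr_measure cH bC).
  by move=> k j; rewrite (fourier_repr_measure cH bC) AT.
- move=> [mu [/Vinfty_bounded[M bmu] /AE ->]]; exists M.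
  exact: bounded_measure_matrix dotP _ _ cH bmu.
- move=> mu vmu /AE ->; have [bmu mumin] := Vinfty_norm_bounded vmu.
  (* [bV] makes the norm of mu one of the matrix bounds, and [lbV] makes it the least. *)
  have bV := bounded_measure_matrix dotP cH bmu.
  have lbV : lbound [set C | matrix_bound (fun k j : nat => fourier mu (j%:Z - k%:Z)) C]
      (Vinfty_norm mu).
    by move=> C bC; apply: mumin; exact: bounded_measure_sharp cH bmu bC.
  apply/eqP; rewrite eq_le; apply/andP; split.
    by apply: ge_inf => //; exists (Vinfty_norm mu).
  by apply: lb_le_inf => //; exists (Vinfty_norm mu).
Qed.
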